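(* Consider the Chaplygin ball in $\mathbb R^n$ rolling without slipping over a fixed $(n-1)$-dimensional sphere (any of the cases (i), (ii), (iii) described in the context), i.e. the nonholonomic Lagrangian system $(SO(n)\times S^{n-1},L,\mathcal D^{\pm})$, and let $\epsilon=\sigma/(\sigma\pm\rho)$. (i) In the variables $(\mathbf k,g,\gamma)\in T^*SO(n)\times S^{n-1}$, the complete set of equations of motion is $$\dot{\mathbf k}=[\mathbf k,\omega],\qquad \dot g=g\cdot\omega,\qquad \dot\gamma=-\epsilon\,\omega\gamma .$$ (ii) The reduction of the left $SO(n)$-symmetry $a\cdot(\omega,\dot\gamma,g,\gamma)=(\omega,\dot\gamma,ag,\gamma)$, $a\in SO(n)$, gives the system on $so(n)^*\times S^{n-1}$ defined by the equations $$\dot{\mathbf k}=[\mathbf k,\omega],\qquad \dot\gamma=-\epsilon\,\omega\gamma .$$ Here $\omega=\kappa^{-1}(\mathbf k)$, with $\kappa=\kappa_\gamma$ defined in the context.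
   Context: Vectors of $\mathbb R^n$ are columns, $(x,y)=x^Ty$, $x\otimes y=xy^T$, $x\wedge y=xy^T-yx^T$. Identify $so(n)\cong so(n)^*$ by $\langle X,Y\rangle=-\frac12\mathrm{tr}(XY)$. Setting. A ball of radius $\rho>0$ and mass $m>0$, with mass center $C$ at its geometric center, rolls over a fixed sphere of radius $\sigma>0$ centered at the origin $O$: (i) over the outer surface of the fixed sphere; (ii) over the inner surface ($\sigma>\rho$); (iii) over the outer surface, the fixed sphere lying inside the rolling spherical shell ($\sigma<\rho$). In every sign $\pm$ take $+$ in case (i) and $-$ in cases (ii), (iii). Put $\epsilon=\frac{\sigma}{\sigma\pm\rho}$, $D=m\rho^2$. The configuration is $(g,\mathbf r)$, with $g\in SO(n)$ the rotation matrix (body frame to space frame) and $\mathbf r=\overrightarrow{OC}$ in the sphere $(\mathbf r,\mathbf r)=(\sigma\pm\rho)^2$, identified with $S^{n-1}$. Put $\omega=g^{-1}\dot g$, $\mathbf V=\dot{\mathbf r}$, $\mathbf\Gamma=\frac{1}{\sigma\pm\rho}\mathbf r$, $\gamma=g^{-1}\mathbf\Gamma\in S^{n-1}$. The Lagrangian is $$L=\tfrac12\langle\mathbb I\omega,\omega\rangle+\tfrac12m(\mathbf V,\mathbf V),$$ where $\mathbb I:so(n)\to so(n)$ is symmetric positive definite (inertia tensor). The no-slip constraint defines the distribution $$\mathcal D^{\pm}=\{(\omega,\mathbf V,g,\mathbf r)\mid \mathbf V=\pm\rho\,\mathrm{Ad}_g(\omega)\mathbf\Gamma\},\qquad \mathrm{Ad}_g(\omega)=g\omega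 g^{-1}.$$ Motions are the solutions of the Lagrange–d'Alembert equations: curves tangent to $\mathcal D^\pm$ along which $\frac{d}{dt}\frac{\partial L}{\partial\dot q}-\frac{\partial L}{\partial q}$ annihilates $\mathcal D^\pm$. The pair $(g,\gamma)$ is used instead of $(g,\mathbf r)$ as coordinates on the configuration space, and $\mathcal D^\pm\cong TSO(n)\times S^{n-1}$ via $(\omega,g,\gamma)$. It is identified with $T^*SO(n)\times S^{n-1}$ (left trivialization) by $$\mathbf k=\kappa(\omega)=\mathbb I\omega+D(\omega\,\gamma\otimes\gamma+\gamma\otimes\gamma\,\omega)\in so(n)\cong so(n)^*,$$ the angular momentum relative to the contact point. *)

(* Defs.v *)
From mathcomp Require Import all_boot all_order all_algebra.
From mathcomp Require Import all_classical all_reals all_analysis.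

Set Implicit Arguments.
Unset Strict Implicit.
Unset Printing Implicit Defensive.

Import Order.TTheory GRing.Theory Num.Theory.
Import numFieldNormedType.Exports.

Local Open Scope classical_set_scope.
Local Open Scope ring_scope.

Section Orthogonal.
Context (R : realType) (n : nat).
Implicit Types (X Y : 'M[R]_n) (x y : 'cV[R]_n).

Definition dot x y : R := (x^T *m y) 0 0.

Definition tensor x y : 'M[R]_n := x *m y^T.

Definition bracket X Y : 'M[R]_n := X *m Y - Y *m X.

Definition pairing X Y : R := - (2^-1 * \tr (X *m Y)).

Definition SO : set 'M[R]_n := [set g | g^T *m g = 1%:M /\ \det g = 1].

Definition so : set 'M[R]_n := [set X | X^T = - X].

Definition sphere : set 'cV[R]_n := [set x | dot x x = 1].

Definition Ad (g w : 'M[R]_n) : 'M[R]_n := g *m w *m invmx g.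

(* A linear map so(n) -> so(n) is given by a linear map on all matrices
   preserving so(n); its values off so(n) are unconstrained. *)
Definition inertia_tensor (I : {linear 'M[R]_n -> 'M[R]_n}) : Prop :=
  [/\ forall X, so X -> so (I X),
      forall X Y, so X -> so Y -> pairing (I X) Y = pairing X (I Y) &
      forall X, so X -> X != 0 -> 0 < pairing (I X) X].

End Orthogonal.

(* Outer: the ball rolls over the outer surface; Inner: over the inner surface;
   Shell: over the outer surface, with the fixed sphere inside the ball. *)
Inductive rolling_case := Outer | Inner | Shell.

Definition admissible (R : realType) (c : rolling_case) (sigma rho : R) : bool :=
  match c with
  | Outer => true
  | Inner => rho < sigma
  | Shell => sigma < rho
  end.

Definition pm (R : realType) (c : rolling_case) : R :=
  match c with Outer => 1 | Inner | Shell => -1 end.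

(* Lagrange-d'Alembert equations, with the configuration space Q contained in
   a normed space V and its tangent vectors seen as vectors of V. *)
Section LagrangeDAlembert.
Context (R : realType) (V : normedModType R).

(* < d/dt (dL/dq') - dL/dq , d > at time t along the curve q, for L a function
   of (position, velocity), smooth near TQ in V * V.  For d tangent to Q at q t
   and q a curve in Q, the value depends only on the restriction of L to TQ:
   it is the intrinsic Euler-Lagrange covector of Q applied to d. *)
Definition euler_lagrange (L : V -> V -> R) (q : R -> V) (t : R) (d : V) : R :=
  'D_1 (fun s : R => 'D_d (L (q s)) ('D_1 q s)) t
  - 'D_d (fun x => L x ('D_1 q t)) (q t).

(* Motions on the time interval J; membership in D includes q t \in Q. *)
Definition lagrange_dalembert (L : V -> V -> R) (D : set (V * V))
    (J : set R) (q : R -> V) : Prop :=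
  forall t, J t ->
    [/\ derivable q t 1, derivable ('D_1 q) t 1, D (q t, 'D_1 q t) &
        forall d, D (q t, d) -> euler_lagrange L q t d = 0].

End LagrangeDAlembert.

Section ChaplyginBall.
Context (R : realType) (n : nat) (c : rolling_case) (sigma rho m : R)
  (I : {linear 'M[R]_n -> 'M[R]_n}).

(* (g, r); velocities (g', r') live in the same space. *)
Local Notation ambient := ('M[R]_n * 'cV[R]_n)%type.

Implicit Types (q v : ambient) (s : ambient * ambient).

(* Negative in the case Shell; the distance |OC| is its absolute value. *)
Definition center_radius : R := sigma + pm R c * rho.

Definition epsilon : R := sigma / center_radius.

Definition config : set ambient :=
  [set q | SO q.1 /\ dot q.2 q.2 = center_radius ^+ 2].

Definition omega q v : 'M[R]_n := invmx q.1 *m v.1.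

Definition Gamma q : 'cV[R]_n := center_radius^-1 *: q.2.

Definition gamma q : 'cV[R]_n := invmx q.1 *m Gamma q.

(* Time derivative of gamma along a curve through q with velocity v, where
   (g^-1)' = - omega g^-1. *)
Definition gamma_dot q v : 'cV[R]_n :=
  invmx q.1 *m (center_radius^-1 *: v.2) - omega q v *m gamma q.

Definition lagrangian q v : R :=
  2^-1 * pairing (I (omega q v)) (omega q v) + 2^-1 * m * dot v.2 v.2.

Definition tangent_bundle : set (ambient * ambient) :=
  [set s | [/\ config s.1, so (omega s.1 s.2) & dot s.1.2 s.2.2 = 0]].

Definition noslip_distribution : set (ambient * ambient) :=
  [set s | tangent_bundle s /\
    s.2.2 = (pm R c * rho) *: (Ad s.1.1 (omega s.1 s.2) *m Gamma s.1)].

Definition motion : set R -> (R -> ambient) -> Prop :=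
  lagrange_dalembert lagrangian noslip_distribution.

Definition kappa (x : 'cV[R]_n) (w : 'M[R]_n) : 'M[R]_n :=
  I w + (m * rho ^+ 2) *: (w *m tensor x x + tensor x x *m w).

Definition kappa_inv (x : 'cV[R]_n) : 'M[R]_n -> 'M[R]_n :=
  'pinv_(fun=> 0) (@so R n) (kappa x).

(* The identification of the distribution with T^*SO(n) * S^{n-1}, given by
   the variables (k, g, gamma). *)
Definition phase_point s : 'M[R]_n * 'M[R]_n * 'cV[R]_n :=
  (kappa (gamma s.1) (omega s.1 s.2), s.1.1, gamma s.1).

Definition phase_space : set ('M[R]_n * 'M[R]_n * 'cV[R]_n) :=
  so (n := n) `*` SO (n := n) `*` sphere (n := n).

Definition full_equations (J : set R) (k g : R -> 'M[R]_n)
    (x : R -> 'cV[R]_n) : Prop :=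
  forall t, J t -> phase_space (k t, g t, x t) /\
    let w := kappa_inv (x t) (k t) in
    [/\ is_derive t 1 k (bracket (k t) w),
        is_derive t 1 g (g t *m w) &
        is_derive t 1 x (- epsilon *: (w *m x t))].

(* The quotient map of the left SO(n)-action, in the variables (k, gamma). *)
Definition reduced_point s : 'M[R]_n * 'cV[R]_n :=
  (kappa (gamma s.1) (omega s.1 s.2), gamma s.1).

Definition reduced_space : set ('M[R]_n * 'cV[R]_n) :=
  so (n := n) `*` sphere (n := n).

Definition reduced_equations (J : set R) (k : R -> 'M[R]_n)
    (x : R -> 'cV[R]_n) : Prop :=
  forall t, J t -> reduced_space (k t, x t) /\
    let w := kappa_inv (x t) (k t) in
    is_derive t 1 k (bracket (k t) w) /\
    is_derive t 1 x (- epsilon *: (w *m x t)).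

(* The coordinates (omega, gamma', g, gamma) on TQ, in which the left action
   of SO(n) is given by coord_action. *)
Definition coordinates s : 'M[R]_n * 'cV[R]_n * 'M[R]_n * 'cV[R]_n :=
  (omega s.1 s.2, gamma_dot s.1 s.2, s.1.1, gamma s.1).

Definition coord_action (a : 'M[R]_n)
    (z : 'M[R]_n * 'cV[R]_n * 'M[R]_n * 'cV[R]_n) :=
  let '(w, xd, g, x) := z in (w, xd, a *m g, x).

(* The action in the variables (g, r), and its tangent lift. *)
Definition act (a : 'M[R]_n) q : ambient := (a *m q.1, a *m q.2).

Definition lifted_act (a : 'M[R]_n) s : ambient * ambient :=
  (act a s.1, act a s.2).

End ChaplyginBall.

(* Main.v *)
From HB Require Import structures.
Require Import Defs.
From mathcomp Require Import all_boot all_order all_algebra.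
From mathcomp Require Import all_classical all_reals all_analysis.
From mathcomp Require Import ring lra.
Import Order.TTheory GRing.Theory Num.Theory.
Import numFieldNormedType.Exports.
Local Open Scope classical_set_scope.
Local Open Scope ring_scope.

Set Implicit Arguments.
Unset Strict Implicit.
Unset Printing Implicit Defensive.

(* Along a curve satisfying the constraint, a direction d tangent to the
   distribution is determined by xi = g^-1 d.1 in so(n), and the Euler-Lagrange
   covector applied to d is the pairing of k' - [k, w] with xi: the kinetic
   energy of rotation contributes I w' - [I w, w], and m (r'', d.2) contributes
   m rho^2 ((w' + (1 - eps) w^2) x, xi x), whose so(n)-gradient is the rest of
   k' - [k, w] since x' = - eps w x. As xi is arbitrary, motions are exactly the
   solutions of k' = [k, w].

   Conversely, a solution (k, g, x) yields a curve that is twice differentiable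
   because w = kappa_x^-1 k depends smoothly on (x, k). For the reduced system g
   is recovered from the linear equation g' = g w, solved on the whole interval
   by the Picard series; g stays in SO(n) since g g^T is constant and det g is
   continuous with values in {1, -1}. *)

(** * Matrix calculus *)

Section MatrixCalculus.
Context {R : realType}.

(** The three rolling cases are told apart only in [radius_neq0] and [pm_sqr]. The signed radius may
    be negative, and all other computations use only that it is nonzero and that the sign squares to
    1. The map [state] solves the no-slip condition for the velocity in terms of [(g, w, x)]. The
    second derivative of the center is then obtained by differentiating this formula along the
    curve, which is why [m (r'', d.2)] is an expression in [w], [w'] and [x] alone. The obstacle in
    the converse is one of order: a motion must have a derivable velocity, while the first-order
    system gives one derivative of [k], [g] and [x]. So [w] itself has to be differentiated,
    although [kappa_inv] is an abstractly chosen inverse with no regularity of its own; an explicit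
    matrix inverse replaces it. All identities hold on [J] only, and derivatives are local; since
    [J] is open, two curves equal on [J] are equal near each of its points and have the same
    derivative there. For the reconstruction of [g], linearity of [g' = g w] gives bounds on each
    compact subinterval, hence a solution on all of [J] and not just near the initial time. *)

Lemma is_derive1P (V : normedModType R) (f : R -> V) (t : R) df :
  is_derive t 1 f df <-> h^-1 *: (f (h + t) - f t) @[h --> 0^'] --> df.
Proof.
have E : (fun h : R => h^-1 *: (f (h + t) - f t)) =
    fun h => h^-1 *: ((f \o shift t) (h *: 1) - f t).
  by apply/funext => h /=; rewrite [h *: 1]mulr1.
rewrite E; split=> [[/cvg_ex[l fl] <-]|fl]; first by rewrite /derive (cvg_lim _ fl).
by split; [apply/cvg_ex; exists df | apply/cvg_lim].
Qed.

Lemma is_derive_continuous {V : normedModType R} {f : R -> V} {t : R} {df} :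
  is_derive t 1 f df -> {for t, continuous f}.
Proof. by case=> /derivable1_diffP df' _; exact: differentiable_continuous. Qed.

Lemma is_derive_pairP (V W : normedModType R) (q : R -> V * W) (t : R) dq :
  is_derive t 1 q dq <->
  is_derive t 1 (fun s => (q s).1) dq.1 /\ is_derive t 1 (fun s => (q s).2) dq.2.
Proof.
rewrite !is_derive1P; case: dq => d1 d2 /=; split=> [qd|[q1 q2]].
  split.
    have := cvg_comp _ _ qd (@cvg_fst _ _ (nbhs d1) (nbhs d2) _).
    exact.
  have := cvg_comp _ _ qd (@cvg_snd _ _ (nbhs d1) (nbhs d2) _).
  exact.
exact: (cvg_pair q1 q2).
Qed.

Lemma is_derive_mxP m n (M : R -> 'M[R]_(m, n)) (t : R) dM :
  is_derive t 1 M dM <->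
  forall i j, is_derive t 1 (fun s => M s i j) (dM i j).
Proof.
split=> [[dMt <-] i j|dMt].
  split; first by move/derivable_mxP : dMt.
  by rewrite derive_mx// mxE.
have d1 : derivable M t 1 by apply/derivable_mxP => i j; case: (dMt i j).
split=> //; rewrite derive_mx//; apply/matrixP => i j; rewrite mxE.
by case: (dMt i j).
Qed.

Lemma is_derive_bigsum (J : finType) (f : J -> R -> R) df (t : R) :
  (forall i, is_derive t 1 (f i) (df i)) ->
  is_derive t 1 (fun s => \sum_i f i s) (\sum_i df i).
Proof.
move=> fd.
suff H (r : seq J) : is_derive t 1 (fun s => \sum_(i <- r) f i s) (\sum_(i <- r) df i).
  exact: H.
elim: r => [|i r IH].
  rewrite big_nil (_ : (fun _ => _) = cst 0); first exact: is_derive_cst.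
  by apply/funext => s; rewrite big_nil.
rewrite big_cons (_ : (fun _ => _) = f i + fun s => \sum_(i <- r) f i s).
  exact: is_deriveD.
by apply/funext => s; rewrite big_cons.
Qed.

Lemma is_derive_mulr (f g : R -> R) (t : R) df dg :
  is_derive t 1 f df -> is_derive t 1 g dg ->
  is_derive t 1 (fun s => f s * g s) (df * g t + f t * dg).
Proof.
move=> fd gd; rewrite (_ : (fun _ => _) = f * g) //.
apply: is_derive_eq; rewrite addrC [df * _]mulrC; reflexivity.
Qed.

Lemma is_derive_mulmx m n p (A : R -> 'M[R]_(m, n)) (B : R -> 'M[R]_(n, p)) (t : R) dA dB :
  is_derive t 1 A dA -> is_derive t 1 B dB ->
  is_derive t 1 (fun s => A s *m B s) (dA *m B t + A t *m dB).
Proof.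
move=> /is_derive_mxP Ad /is_derive_mxP Bd; apply/is_derive_mxP => i j.
rewrite !mxE -big_split/= (_ : (fun s => _) = fun s => \sum_k A s i k * B s k j).
  by apply: is_derive_bigsum => k; exact: is_derive_mulr.
by apply/funext => s; rewrite mxE.
Qed.

(** Continuity of [L] comes for free in finite dimension: on the elementary matrices, each entry of
    [L (A s)] is a finite sum of entries of [A s] with constant coefficients. *)
Lemma is_derive_linear_mx m n p q (L : {linear 'M[R]_(m, n) -> 'M[R]_(p, q)}) A (t : R) dA :
  is_derive t 1 A dA -> is_derive t 1 (fun s => L (A s)) (L dA).
Proof.
have E M k l : L M k l = \sum_i \sum_j M i j * L (delta_mx i j) k l.
  rewrite {1}(matrix_sum_delta M) linear_sum summxE; apply: eq_bigr => i _.
  by rewrite linear_sum summxE; apply: eq_bigr => j _; rewrite linearZ mxE.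
move=> /is_derive_mxP Ad; apply/is_derive_mxP => k l.
rewrite E (_ : (fun s => _) =
  fun s => \sum_i \sum_j A s i j * L (delta_mx i j) k l); last first.
  by apply/funext => s; exact: E.
apply: is_derive_bigsum => i; apply: is_derive_bigsum => j.
have := is_derive_mulr (Ad i j) (is_derive_cst (L (delta_mx i j) k l) t 1).
by rewrite mulr0 addr0.
Qed.

Lemma is_derive_mxtrace n (A : R -> 'M[R]_n) (t : R) dA :
  is_derive t 1 A dA -> is_derive t 1 (fun s => \tr (A s)) (\tr dA).
Proof. by move=> /is_derive_mxP Ad; apply: is_derive_bigsum. Qed.

Lemma derivable_bigprod (J : Type) (r : seq J) (f : J -> R -> R) (t : R) :
  (forall i, derivable (f i) t 1) -> derivable (fun s => \prod_(i <- r) f i s) t 1.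
Proof.
move=> fd; elim: r => [|i r IH].
  rewrite (_ : (fun _ => _) = cst 1); first exact: derivable_cst.
  by apply/funext => s; rewrite big_nil.
rewrite (_ : (fun _ => _) = f i * fun s => \prod_(i <- r) f i s).
  exact: (derivableM (fd i) IH).
by apply/funext => s; rewrite big_cons.
Qed.

Lemma derivable_det n (A : R -> 'M[R]_n) (t : R) :
  derivable A t 1 -> derivable (fun s => \det (A s)) t 1.
Proof.
move/derivable_mxP => Ad.
suff [df dfP] : exists df, is_derive t 1 (fun s => \det (A s)) df by case: dfP.
eexists; apply: is_derive_bigsum => u; apply: derivableP.
apply: derivableM; first exact: derivable_cst.
exact: derivable_bigprod.
Qed.

Lemma near_unitmx n (A : R -> 'M[R]_n) (t : R) :
  derivable A t 1 -> A t \in unitmx -> \forall s \near t, A s \in unitmx.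
Proof.
move=> Ad; rewrite unitmxE unitfE => At.
have /derivable1_diffP/differentiable_continuous dc := derivable_det Ad.
have dn0 := cvgr_neq0 _ dc At.
near=> s; rewrite unitmxE unitfE; near: s; exact: dn0.
Unshelve. all: by end_near. Qed.

(** Derivability comes from Cramer's formula, available only near [t], since [invmx] returns a
    singular matrix unchanged. The value then follows by differentiating
    [A s *m invmx (A s) = 1]. *)
Lemma is_derive_invmx n (A : R -> 'M[R]_n) (t : R) dA :
  is_derive t 1 A dA -> A t \in unitmx ->
  is_derive t 1 (fun s => invmx (A s)) (- (invmx (A t) *m dA *m invmx (A t))).
Proof.
move=> Ad At.
have Adt : derivable A t 1 by case: Ad.
have nA := near_unitmx Adt At.
have dinv : derivable (fun s => invmx (A s)) t 1.
  apply: (@near_eq_derivable _ _ _ (fun s => (\det (A s))^-1 *: \adj (A s))).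
    near=> s; have As : A s \in unitmx by near: s; exact: nA.
    rewrite /invmx As. by [].
  apply/derivable_mxP => i j.
  rewrite (_ : (fun s => _) =
    (fun s => (\det (A s))^-1) * (fun s => \adj (A s) i j)); last first.
    by apply/funext => s; rewrite mxE.
  apply: derivableM.
    apply: derivableV; last exact: derivable_det.
    by move: At; rewrite unitmxE unitfE.
  rewrite (_ : (fun s => _) =
    (fun s => (-1) ^+ (j + i) * \det (row' j (col' i (A s))))); last first.
    by apply/funext => s; rewrite mxE.
  apply: derivableM; first exact: derivable_cst.
  apply: derivable_det; apply/derivable_mxP => k l.
  rewrite (_ : (fun s => _) = (fun s => A s (lift j k) (lift i l))).
    by move/derivable_mxP : Adt.
  by apply/funext => s; rewrite !mxE.
have [_ dAinv] := is_derive_mulmx Ad (derivableP dinv).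
have d1 : 'D_1 (fun s => A s *m invmx (A s)) t = 0.
  rewrite (@near_eq_derive _ _ _ _ (cst 1%:M)) ?derive_cst//.
  near=> s; have As : A s \in unitmx by near: s; exact: nA.
  by rewrite mulmxV.
split=> //; rewrite dAinv addrC in d1; move/eqP: d1.
rewrite addr_eq0 => /eqP E.
by rewrite -[LHS](mulKmx At) E mulmxN mulmxA.
Unshelve. all: by end_near. Qed.

(** Turns the partial derivatives of the Lagrangian into derivatives along a line, so that the rules
    for curves apply to them. *)
Lemma derive_line (V W : normedModType R) (f : V -> W) a d :
  'D_d f a = 'D_1 (fun h : R => f (h *: d + a)) 0.
Proof.
rewrite /derive; set u := (fun h => _); set v := (fun h => h^-1 *: _).
suff -> : u = v by [].
by apply/funext => h; rewrite /u /v/= scale0r add0r addr0 [_%:A]mulr1.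
Qed.

End MatrixCalculus.

(** * Primitives *)

Section Primitive.
Context {R : realType}.

Lemma open_interval_neighborhood (J : set R) t :
  open J -> J t -> exists a b, [/\ a < t, t < b, J a & J b].
Proof.
move=> oJ Jt.
have /nbhs_ballP[e/= e0 eJ] : nbhs t J by exact: open_nbhs_nbhs.
exists (t - e / 2), (t + e / 2); split.
- by rewrite ltrBlDr ltrDl divr_gt0.
- by rewrite ltrDl divr_gt0.
- apply: eJ; rewrite /ball/= opprB addrC subrK ger0_norm ?divr_ge0 ?ltW//.
  by rewrite ltr_pdivrMr// ltr_pMr// ltr1n.
- apply: eJ; rewrite /ball/= opprD addNKr normrN ger0_norm ?divr_ge0 ?ltW//.
  by rewrite ltr_pdivrMr// ltr_pMr// ltr1n.
Qed.

Lemma interval_sub (J : set R) a b t : is_interval J -> J a -> J b ->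
  a <= t <= b -> J t.
Proof. by move=> iJ Ja Jb tab; exact: (iJ a b). Qed.

Lemma interval_between (J : set R) a b (l : R) : is_interval J -> J a -> J b ->
  0 <= l <= 1 -> J (a + l * (b - a)).
Proof.
move=> iJ Ja Jb /andP[l0 l1].
have [ab|/ltW ba] := leP a b.
  apply: (interval_sub iJ Ja Jb); apply/andP; split.
    by rewrite lerDl mulr_ge0 ?subr_ge0.
  by rewrite -lerBrDl ler_piMl ?subr_ge0.
apply: (interval_sub iJ Jb Ja); apply/andP; split; last first.
  by rewrite gerDl mulr_ge0_le0 ?subr_le0.
by rewrite -[b - a]opprB mulrN lerBrDr -lerBrDl ler_piMl ?subr_ge0.
Qed.

(** Writing the intermediate point as [a + l * (b - a)] lets one formula serve both orders of [a]
    and [b] as well as [a = b]. *)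
Lemma MVT_between (J : set R) (f df : R -> R) a b : is_interval J ->
  J a -> J b -> (forall s, J s -> is_derive s 1 f (df s)) ->
  exists2 l, 0 <= l <= 1 & f b - f a = df (a + l * (b - a)) * (b - a).
Proof.
have main x y : is_interval J -> J x -> J y ->
    (forall s, J s -> is_derive s 1 f (df s)) -> x < y ->
    exists2 c, x < c < y & f y - f x = df c * (y - x).
  move=> iJ Jx Jy fd xy.
  have [s /[!in_itv]/=/andP[xs sy]||c] := @MVT R f df x y xy.
  - by apply/fd/(interval_sub iJ Jx Jy); rewrite !ltW.
  - apply: derivable_within_continuous => s; rewrite in_itv/= => sxy.
    by case: (fd s (interval_sub iJ Jx Jy sxy)).
  - by rewrite in_itv/= => cxy E; exists c.
move=> iJ Ja Jb fd; have [ab|ba|ab] := ltgtP a b.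
- have [c /andP[ac cb] ->] := main a b iJ Ja Jb fd ab.
  have ba0 : 0 < b - a by rewrite subr_gt0.
  exists ((c - a) / (b - a)).
    rewrite divr_ge0 ?subr_ge0 ?(ltW ac) ?(ltW ab)//= ler_pdivrMr// mul1r.
    by rewrite lerB// ltW.
  by rewrite divfK ?gt_eqF// [a + _]addrC subrK.
- have [c /andP[bc ca]] := main b a iJ Jb Ja fd ba.
  have ba0 : b - a < 0 by rewrite subr_lt0.
  move=> E; exists ((c - a) / (b - a)).
    rewrite mulr_le0 ?invr_le0 ?subr_le0 ?(ltW ca) ?(ltW ba)//=.
    by rewrite ler_ndivrMr// mul1r lerB// ltW.
  rewrite divfK ?lt_eqF// [a + _]addrC subrK.
  by rewrite -[LHS]opprB E -mulrN opprB.
- by exists 0; [rewrite lexx ler01 | rewrite ab !subrr mulr0].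
Qed.

(** The bound is the integral of [C |s - t0|^k]. The division by [k + 1] builds the factorials of
    the Picard estimate, and the case [k = 0] identifies the limit of the series. *)
Lemma growth_bound (J : set R) (f df : R -> R) t0 t (C : R) k : is_interval J ->
  J t0 -> J t -> (forall s, J s -> is_derive s 1 f (df s)) -> f t0 = 0 ->
  (forall s, J s -> `|df s| <= C * `|s - t0| ^+ k) ->
  `|f t| <= C * `|t - t0| ^+ k.+1 / k.+1%:R.
Proof.
move=> iJ J0 Jt fd f0 bd.
pose e : R := if t0 <= t then 1 else -1.
have ee : e * e = 1 by rewrite /e; case: ifP => _; rewrite ?mulr1 ?mulrNN ?mulr1.
have et : e * (t - t0) = `|t - t0|.
  rewrite /e; have [tt|tt] := leP t0 t.
    by rewrite mul1r ger0_norm ?subr_ge0.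
  by rewrite mulN1r ltr0_norm ?subr_lt0.
(* [e] is the sign of [t - t0], and the mean value theorem is applied to
   [d f - C |s - t0|^(k+1) / (k+1)] with [d = 1] and [d = -1]. *)
have main (d : R) : `|d| = 1 -> d * f t <= C * `|t - t0| ^+ k.+1 / k.+1%:R.
  move=> d1.
  pose psi s := d * f s - C / k.+1%:R * (e * (s - t0)) ^+ k.+1.
  have psid s : J s -> is_derive s 1 psi (d * df s - e * C * (e * (s - t0)) ^+ k).
    move=> Js.
    have h1 : is_derive s 1 (fun s => d * f s) (d * df s).
      have := is_derive_mulr (is_derive_cst d s 1) (fd s Js).
      by rewrite mul0r add0r.
    have h2 : is_derive s 1 (fun s => e * (s - t0)) e.
      have h3 : is_derive s 1 (fun s => s - t0) 1.
        rewrite (_ : (fun _ => _) = id - cst t0)//.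
        by apply: is_derive_eq; rewrite subr0.
      have := is_derive_mulr (is_derive_cst e s 1) h3.
      by rewrite mul0r add0r mulr1.
    have h4 : is_derive s 1 (fun s => (e * (s - t0)) ^+ k.+1)
        (k.+1%:R * (e * (s - t0)) ^+ k * e).
      rewrite (_ : (fun _ => _) = (fun s => e * (s - t0)) ^+ k.+1); last first.
        by apply/funext => x; rewrite fctE.
      exact: is_derive_eq.
    have h5 := is_derive_mulr (is_derive_cst (C / k.+1%:R) s 1) h4.
    have -> : psi = (fun s => d * f s) -
       (fun s => C / k.+1%:R * (e * (s - t0)) ^+ k.+1) by [].
    apply: is_derive_eq; congr (_ - _).
    rewrite mul0r add0r mulrA mulrA divfK ?pnatr_eq0//.
    by rewrite mulrAC [C * e]mulrC.
  have [l l01] := MVT_between iJ J0 Jt psid.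
  set c := t0 + _ => E.
  have Jc : J c by exact: interval_between.
  have ec : e * (c - t0) = `|c - t0|.
    rewrite /c [t0 + _]addrC addrK mulrCA et normrM.
    by rewrite ger0_norm//; case/andP: l01.
  have psi0 : psi t0 = 0 by rewrite /psi f0 [t0 - t0]subrr !mulr0 expr0n/= mulr0 subrr.
  have : psi t <= 0.
    move: E; rewrite psi0 subr0 => ->.
    have -> : t - t0 = e * `|t - t0| by rewrite -et mulrA ee mul1r.
    rewrite mulrA mulr_le0_ge0// ec.
    set p := `|_| ^+ k.
    have -> : (d * df c - e * C * p) * e = d * df c * e - e * e * (C * p) by ring.
    rewrite ee mul1r subr_le0.
    apply: (le_trans _ (bd c Jc)); apply: (le_trans (ler_norm _)).
    rewrite !normrM d1 mul1r.
    have -> : `|e| = 1 by rewrite /e; case: ifP => _; rewrite ?normrN normr1.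
    by rewrite mulr1.
  rewrite /psi subr_le0 et => /le_trans; apply.
  by rewrite mulrAC.
rewrite ler_norml; apply/andP; split; last first.
  by rewrite -[f t]mul1r main// normr1.
by rewrite lerNl -mulN1r main// normrN normr1.
Qed.

Lemma primitive_right (J : set R) (f : R -> R) a : open J -> is_interval J ->
  J a -> (forall t, J t -> {for t, continuous f}) ->
  forall t, J t -> a < t ->
  is_derive t 1 (fun y => \int[lebesgue_measure]_(s in `[a, y]) f s) (f t).
Proof.
move=> oJ iJ Ja fc t Jt at_.
have [_ [u [_ tu _ Ju]]] := open_interval_neighborhood oJ Jt.
have fi : lebesgue_measure.-integrable `[a, u] (EFin \o f).
  apply: continuous_compact_integrable; first exact: segment_compact.
  apply: continuous_in_subspaceT => s; rewrite inE/= in_itv/= => sau.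
  exact/fc/(interval_sub iJ Ja Ju).
have [d1 d2] := continuous_FTC1_closed tu fi at_ (fc t Jt).
split; first exact: d1.
by rewrite -derive1E; exact: d2.
Qed.

Lemma exists_primitive (J : set R) (f : R -> R) t0 : open J -> is_interval J ->
  J t0 -> (forall t, J t -> {for t, continuous f}) ->
  exists F, F t0 = 0 /\ forall t, J t -> is_derive t 1 F (f t).
Proof.
move=> oJ iJ J0 fc.
pose G a y := \int[lebesgue_measure]_(s in `[a, y]) f s.
(* The integral over [[t0, t]] is 0 when [t < t0], as the interval is then empty; the left side
   needs its own branch with the opposite sign. *)
exists (fun t => if t0 <= t then G t0 t else - G t t0).
rewrite lexx; split=> [|t Jt]; first by rewrite /G set_itv1 Rintegral_set1.
(* A base point to the left of both [t] and [t0] merges the two branches into [G a y - G a t0] near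
   [t], to which [primitive_right] applies. *)
have [a [aJ at_ at0]] : exists a, [/\ J a, a < t & a < t0].
  have [a1 [_ [h1 _ J1 _]]] := open_interval_neighborhood oJ Jt.
  have [a2 [_ [h2 _ J2 _]]] := open_interval_neighborhood oJ J0.
  have [a12|a21] := leP a1 a2.
    by exists a1; split=> //; exact: le_lt_trans h2.
  by exists a2; split=> //; exact: lt_trans h1.
have GB x y : J y -> a < x -> x <= y -> G a y - G a x = G x y.
  move=> Jy ax xy; rewrite /G Rintegral_itvB.
  - apply: Rintegral_itv_obnd_cbnd.
    have xyi : lebesgue_measure.-integrable `[x, y] (EFin \o f).
      apply: continuous_compact_integrable; first exact: segment_compact.
      apply: continuous_in_subspaceT => s; rewrite inE/= in_itv/= => /andP[xs sy].
      apply/fc/(interval_sub iJ aJ Jy); rewrite sy andbT.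
      exact/(le_trans _ xs)/ltW.
    apply: integrableS xyi => //.
    by move=> s /=; rewrite !in_itv/= => /andP[/ltW-> ->].
  - apply: continuous_compact_integrable; first exact: segment_compact.
    apply: continuous_in_subspaceT => s; rewrite inE/= in_itv/= => say.
    exact/fc/(interval_sub iJ aJ Jy).
  - by rewrite bnd_simp ltW.
  - by rewrite bnd_simp.
apply: (@near_eq_is_derive _ _ _ (fun y => G a y - G a t0)).
  near=> y.
  have Jy : J y by near: y; exact: open_nbhs_nbhs.
  have ay : a < y by near: y; exact: lt_nbhsr.
  have [ty|ty] := leP t0 y; first by rewrite GB.
  by rewrite -(GB y t0)// ?opprB// ltW.
have h := primitive_right oJ iJ aJ fc Jt at_.
rewrite (_ : (fun y => _) = G a - cst (G a t0))//.
by apply: is_derive_eq; rewrite subr0.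
Unshelve. all: by end_near. Qed.

End Primitive.

(** * Linear differential equations *)

Section LinearODE.
Context {R : realType}.

(** The Weierstrass comparison test with its remainder: the tail of [v] does not depend on time,
    which makes the error uniform when [u] does. *)
Lemma series_tail_le (u v : R^nat) :
  (forall k, `|u k| <= v k) -> cvgn (series v) ->
  cvgn (series u) /\
  forall N, `|limn (series u) - series u N| <= limn (series v) - series v N.
Proof.
move=> uv cv.
have v0 k : 0 <= v k by exact: le_trans (uv k).
have cu : cvgn (series u).
  by apply: normed_cvg; apply: series_le_cvg cv => // k; exact: normr_ge0.
split=> // N.
have ndv : nondecreasing_seq (series v) by apply: nondecreasing_series => *.
have h : (fun M => `|series u M - series u N|) @ \oo -->
    `|limn (series u) - series u N|.
  by apply: cvg_norm; apply: cvgB => //; exact: cvg_cst.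
apply: (cvgr_to_le h); near=> M.
have NM : (N <= M)%N by near: M; exact: nbhs_infty_ge.
rewrite sub_series_geq//; apply: (le_trans (ler_norm_sum _ _ _)).
apply: (@le_trans _ _ (\sum_(N <= k < M) v k)); first exact: ler_sum.
by rewrite -sub_series_geq// lerD2r nondecreasing_cvgn_le.
Unshelve. all: by end_near. Qed.

Definition mx_continuous_at m n (A : R -> 'M[R]_(m, n)) (t : R) :=
  forall i j, {for t, continuous (fun s => A s i j)}.

Lemma is_derive_mx_continuous m n (A : R -> 'M[R]_(m, n)) (t : R) dA :
  is_derive t 1 A dA -> mx_continuous_at A t.
Proof. by move=> /is_derive_mxP Ad i j; exact: is_derive_continuous. Qed.

Lemma mulmx_continuous m n p (A : R -> 'M[R]_(m, n)) (B : R -> 'M[R]_(n, p)) t :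
  mx_continuous_at A t -> mx_continuous_at B t ->
  mx_continuous_at (fun s => A s *m B s) t.
Proof.
move=> Ac Bc i j.
rewrite (_ : (fun s => _) = fun s => \sum_k A s i k * B s k j); last first.
  by apply/funext => s; rewrite mxE.
elim: (index_enum _) => [|k r IH].
  rewrite (_ : (fun _ => _) = cst 0); first exact: cst_continuous.
  by apply/funext => s; rewrite big_nil.
rewrite (_ : (fun _ => _) = (fun s => A s i k) * (fun s => B s k j) +
    fun s => \sum_(k <- r) A s i k * B s k j); last first.
  by apply/funext => s; rewrite big_cons.
by apply: continuousD => //; apply: continuousM; [exact: Ac | exact: Bc].
Qed.

Lemma exists_primitive_mx m n (J : set R) (f : R -> 'M[R]_(m, n)) t0 :
  open J -> is_interval J -> J t0 ->
  (forall t, J t -> mx_continuous_at f t) ->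
  exists F, F t0 = 0 /\ forall t, J t -> is_derive t 1 F (f t).
Proof.
move=> oJ iJ J0 fc.
have /choice[F FP] : forall p : 'I_m * 'I_n, exists F : R -> R, F t0 = 0 /\
    forall t, J t -> is_derive t 1 F (f t p.1 p.2).
  by move=> p; apply: exists_primitive => // t Jt; exact: fc.
exists (fun t => \matrix_(i, j) F (i, j) t); split.
  by apply/matrixP => i j; rewrite !mxE; case: (FP (i, j)).
move=> t Jt; apply/is_derive_mxP => i j.
rewrite (_ : (fun _ => _) = F (i, j)); first by case: (FP (i, j)) => _; exact.
by apply/funext => s; rewrite mxE.
Qed.

Lemma mulmx_entry_bound m n p (A : 'M[R]_(m, n)) (B : 'M[R]_(n, p)) a b i j :
  (forall i j, `|A i j| <= a) -> (forall i j, `|B i j| <= b) ->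
  `|(A *m B) i j| <= n%:R * a * b.
Proof.
move=> Aa Bb; rewrite mxE; apply: (le_trans (ler_norm_sum _ _ _)).
have -> : n%:R * a * b = \sum_(k < n) a * b.
  by rewrite sumr_const card_ord -mulrA mulr_natl.
by apply: ler_sum => k _; rewrite normrM ler_pM.
Qed.

Context {n : nat}.

Lemma mx_segment_bounded (w : R -> 'M[R]_n) a b : a <= b ->
  (forall t, a <= t <= b -> {for t, continuous w}) ->
  exists2 W, 0 <= W & forall t, a <= t <= b -> forall i j, `|w t i j| <= W.
Proof.
move=> ab wc.
have [|c cab cmax] := @EVT_max R (fun t => `|w t|) a b ab.
  apply: continuous_in_subspaceT => t; rewrite inE/= in_itv/= => tab.
  by apply: continuous_comp; [exact: wc | exact: norm_continuous].
exists `|w c| => // t tab i j.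
apply: le_trans (cmax t _); last by rewrite in_itv.
by rewrite [leRHS]/Num.Def.normr/= mx_normrE; exact: (le_bigmax _ _ (i, j)).
Qed.

Lemma picard_sequence (J : set R) (w : R -> 'M[R]_n) t0 :
  open J -> is_interval J -> J t0 -> (forall t, J t -> mx_continuous_at w t) ->
  exists U : nat -> R -> 'M[R]_n, [/\ U 0 = cst 1%:M, forall k, U k.+1 t0 = 0 &
    forall k t, J t -> is_derive t 1 (U k.+1) (U k t *m w t)].
Proof.
move=> oJ iJ J0 wc.
(* Choice turns taking a primitive into a total operator [P], which can be iterated; its value on a
   function that is not continuous on [J] is arbitrary. *)
have /choice[P PP] : forall f : R -> 'M[R]_n, exists F : R -> 'M[R]_n,
    (forall t, J t -> mx_continuous_at f t) ->
    F t0 = 0 /\ forall t, J t -> is_derive t 1 F (f t).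
  move=> f; have [fc|nfc] := pselect (forall t, J t -> mx_continuous_at f t).
    by have [F FP] := exists_primitive_mx oJ iJ J0 fc; exists F.
  by exists f => /nfc.
pose U k := iter k (fun u => P (fun s => u s *m w s)) (cst 1%:M).
have Uc k : forall t, J t -> mx_continuous_at (U k) t.
  elim: k => [|k IH] t Jt.
    apply: is_derive_mx_continuous; exact: is_derive_cst.
  have [|_ Pd] := PP (fun s => U k s *m w s).
    by move=> s Js; apply: mulmx_continuous; [exact: IH | exact: wc].
  exact: is_derive_mx_continuous (Pd t Jt).
have PU k := PP (fun s => U k s *m w s)
  (fun s Js => mulmx_continuous (Uc k s Js) (wc s Js)).
exists U; split=> // k; first by case: (PU k).
by move=> t Jt; case: (PU k) => _; exact.
Qed.

Lemma picard_bound (J : set R) (w : R -> 'M[R]_n) t0 (U : nat -> R -> 'M[R]_n) W :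
  is_interval J -> J t0 -> 0 <= W ->
  (forall t, J t -> forall i j, `|w t i j| <= W) ->
  U 0 = cst 1%:M -> (forall k, U k.+1 t0 = 0) ->
  (forall k t, J t -> is_derive t 1 (U k.+1) (U k t *m w t)) ->
  forall k t, J t -> forall i j,
    `|U k t i j| <= exp_coeff (n%:R * W * `|t - t0|) k.
Proof.
move=> iJ J0 W0 wW U0 Ut0 Ud; elim=> [|k IH] t Jt i j.
  rewrite U0 /exp_coeff/= expr0 fact0 divr1 mxE.
  by case: (i == j); rewrite ?normr1 ?normr0.
have M0 : 0 <= n%:R * W by rewrite mulr_ge0.
(* The entries of [U k s *m w s] are bounded by [n W] times the bound on [U k], the factor [n] being
   the number of terms in a matrix product. Hence [C = (n W)^(k+1) / k!] in [growth_bound], whose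
   division by [k + 1] completes the factorial. *)
apply: (@le_trans _ _ ((n%:R * W) ^+ k.+1 / k`!%:R * `|t - t0| ^+ k.+1 / k.+1%:R)).
  apply: (growth_bound (J := J) (f := fun s => U k.+1 s i j)
      (df := fun s => (U k s *m w s) i j)) => //.
  - by move=> s Js; have /is_derive_mxP := Ud k s Js; exact.
  - by rewrite Ut0 mxE.
  - move=> s Js; apply: le_trans (mulmx_entry_bound _ _ (IH s Js) (wW s Js)) _.
    rewrite /exp_coeff/= exprMn exprS le_eqVlt; apply/orP; left; apply/eqP.
    by ring.
rewrite /exp_coeff/= [(_ * `|_|) ^+ _]exprMn factS natrM invfM le_eqVlt; apply/orP; left; apply/eqP.
have H (x y z u : R) : x * y * z * u = x * z * (u * y) by ring.
exact: H.
Qed.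

Lemma linear_ode (J : set R) (w : R -> 'M[R]_n) t0 :
  open J -> is_interval J -> J t0 -> (forall t, J t -> {for t, continuous w}) ->
  exists g : R -> 'M[R]_n, g t0 = 1%:M /\
    forall t, J t -> is_derive t 1 g (g t *m w t).
Proof.
move=> oJ iJ J0 wc.
have wce t : J t -> mx_continuous_at w t.
  move=> Jt i j.
  have := @continuous_comp _ _ _ w (fun M : 'M[R]_n => M i j) t (wc t Jt).
  by apply; exact: coord_continuous.
have [U [U0 Ut0 Ud]] := picard_sequence oJ iJ J0 wce.
(* The series [g] of the [U k] is a locally uniform limit, hence continuous, so
   [g w] has a primitive [F]; bounding [(F - S)' = (g - S) w] gives [g = F + 1],
   which avoids differentiating the series term by term. *)
pose S N t := \sum_(k < N) U k t.
pose g t : 'M[R]_n := \matrix_(i, j) limn (series (fun k => U k t i j)).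
have SE N t i j : S N t i j = series (fun k => U k t i j) N.
  by rewrite /S summxE /series/= big_mkord.
(* On a compact interval inside [J] the coefficient [w] is bounded, which it need not be on [J].
   Both [t] and [t0] are interior, so that a neighborhood of [t] shares the estimates started at
   [t0]. *)
have near_t t : J t -> exists a b, [/\ J a, J b, a < t < b & a < t0 < b].
  move=> Jt; have [a1 [b1 [h1 h2 h3 h4]]] := open_interval_neighborhood oJ Jt.
  have [a2 [b2 [k1 k2 k3 k4]]] := open_interval_neighborhood oJ J0.
  exists (Num.min a1 a2), (Num.max b1 b2); split.
  - by rewrite minElt; case: ifP.
  - by rewrite maxElt; case: ifP.
  - by rewrite gt_min lt_max h1 h2.
  - by rewrite gt_min lt_max k1 k2 !orbT.
have unif a b : J a -> J b -> a < t0 < b ->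
    exists2 W, (forall s, a <= s <= b -> forall i j, `|w s i j| <= W) &
    exists2 e : R^nat, e @ \oo --> 0 & forall N s, a <= s <= b -> forall i j,
      `|g s i j - S N s i j| <= e N.
  move=> Ja Jb /andP[a0 b0].
  have subJ s : a <= s <= b -> J s by exact: (interval_sub iJ).
  have ab : a <= b by apply/ltW/(lt_trans a0).
  have [W W0 wW] := mx_segment_bounded ab (fun t tab => wc t (subJ t tab)).
  (* [X] is the largest possible value of [n W |s - t0|] on [[a, b]], so the error is the tail of
     the exponential series at [X]. *)
  exists W => //; pose X := n%:R * W * (b - a).
  exists (fun N => limn (series (exp_coeff X)) - series (exp_coeff X) N).
    rewrite -(subrr (limn (series (exp_coeff X)))).
    by apply: cvgB; [exact: cvg_cst | exact: is_cvg_series_exp_coeff].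
  move=> N s sab i j; rewrite SE mxE.
  apply: (proj2 (series_tail_le _ (is_cvg_series_exp_coeff X)) N) => k.
  have inI x : a <= x <= b <-> `[a, b]%classic x by rewrite /= in_itv.
  have I0 : `[a, b]%classic t0 by apply: (inI t0).1; rewrite (ltW a0) (ltW b0).
  have Ib x : `[a, b]%classic x -> forall i j, `|w x i j| <= W by move/(inI x).2/wW.
  have Id l x : `[a, b]%classic x -> is_derive x 1 (U l.+1) (U l x *m w x).
    by move/(inI x).2/subJ; exact: Ud.
  have := picard_bound (@interval_is_interval _ _) I0 W0 Ib U0 Ut0 Id k.
  move=> /(_ s ((inI s).1 sab) i j) /le_trans; apply.
  have sM : `|s - t0| <= b - a.
    case/andP: sab => as_ sb; rewrite ler_norml; apply/andP; split; last first.
      by rewrite lerB// ltW.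
    by rewrite opprB lerB// ltW.
  rewrite /exp_coeff/= ler_pM2r ?invr_gt0 ?ltr0n ?fact_gt0//.
  by rewrite lerXn2r ?nnegrE ?mulr_ge0 ?ler_wpM2l ?subr_ge0 ?mulr_ge0.
have gc t : J t -> mx_continuous_at g t.
  move=> Jt i j; have [a [b [Ja Jb tab t0ab]]] := near_t t Jt.
  have [W _ [e e0 ge]] := unif a b Ja Jb t0ab.
  have Sc N : {for t, continuous (fun s => S N s i j)}.
    rewrite (_ : (fun s => _) = fun s => \sum_(k < N) U k s i j); last first.
      by apply/funext => s; rewrite summxE.
    elim: (index_enum _) => [|k r IH].
      rewrite (_ : (fun _ => _) = cst 0); first exact: cst_continuous.
      by apply/funext => s; rewrite big_nil.
    rewrite (_ : (fun _ => _) = (fun s => U k s i j) +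
      fun s => \sum_(k <- r) U k s i j); last first.
      by apply/funext => s; rewrite big_cons.
    apply: continuousD => //; case: (val k) => [|l].
      by rewrite U0; exact: cst_continuous.
    exact: (is_derive_mx_continuous (Ud l t Jt)).
  apply/cvgrPdist_le => /= d d0.
  have d3 : 0 < d / 3 by rewrite divr_gt0.
  have /cvgrPdist_le/(_ _ d3)[N _ /(_ N (leqnn _)) eN] := e0.
  have {}eN : e N <= d / 3 by move: eN; rewrite sub0r normrN; exact/le_trans/ler_norm.
  have /cvgrPdist_le/(_ _ d3) SN := Sc N.
  case/andP: (tab) => at_ tb; near=> s.
  have sab : a <= s <= b.
    apply/andP; split; apply: ltW.
      by near: s; exact: lt_nbhsr.
    by near: s; exact: lt_nbhsl.
  have -> : g t i j - g s i j = (g t i j - S N t i j) + (S N t i j - S N s i j) +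
     - (g s i j - S N s i j) by ring.
  have -> : d = d / 3 + d / 3 + d / 3 by field.
  apply: (le_trans (ler_normD _ _)); apply: lerD; last first.
    by rewrite normrN; apply: le_trans eN; exact: ge.
  apply: (le_trans (ler_normD _ _)); apply: lerD.
    apply: le_trans eN; apply: ge; by case/andP: tab => /ltW -> /ltW ->.
  near: s; exact: SN.
have [F [F0 Fd]] := exists_primitive_mx oJ iJ J0
  (fun t Jt => mulmx_continuous (gc t Jt) (wce t Jt)).
have St0 N : S N.+1 t0 = 1%:M.
  by rewrite /S big_ord_recl U0 big1 ?addr0// => k _; exact: Ut0.
have mx_subE (A B : 'M[R]_n) k l : (A - B) k l = A k l - B k l by rewrite !mxE.
have gF t : J t -> g t = F t + 1%:M.
  move=> Jt; have [a [b [Ja Jb tab t0ab]]] := near_t t Jt.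
  have [W wW [e e0 ge]] := unif a b Ja Jb t0ab.
  have subJ s : a <= s <= b -> J s by exact: (interval_sub iJ).
  apply/matrixP => i j.
  (* Differentiation kills the constant [U 0] and lowers every other index by one, hence [S N] in
     the derivative of [S N.+1]. *)
  have Sd N s : J s -> is_derive s 1 (S N.+1) (S N s *m w s).
    move=> Js; apply/is_derive_mxP => k l.
    rewrite (_ : (fun s => _) = (fun s => U 0 s k l) +
        fun s => \sum_(m < N) U m.+1 s k l); last first.
      by apply/funext => x; rewrite /S big_ord_recl mxE summxE.
    rewrite /S mulmx_suml summxE U0 -[X in is_derive _ _ _ X]add0r.
    apply: is_deriveD; first exact: is_derive_cst.
    apply: is_derive_bigsum => m; have /is_derive_mxP := Ud m s Js; exact.
  have bnd N : `|F t i j + 1%:M i j - S N.+1 t i j| <=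
      n%:R * e N * W * `|t - t0| ^+ 1 / 1%:R.
    pose f s := F s i j - (S N.+1 s i j - 1%:M i j).
    have -> : F t i j + 1%:M i j - S N.+1 t i j = f t by rewrite /f; ring.
    apply: (growth_bound (J := `[a, b]) (f := f)
      (df := fun s => ((g s - S N s) *m w s) i j)).
    - exact: interval_is_interval.
    - by case/andP: t0ab => ? ?; rewrite /= in_itv/= !ltW.
    - by case/andP: tab => ? ?; rewrite /= in_itv/= !ltW.
    - move=> s /=; rewrite in_itv/= => /subJ Js.
      rewrite /f (_ : (fun _ => _) = (fun s => F s i j) - ((fun s => S N.+1 s i j) -
        cst (1%:M i j)))//.
      have /is_derive_mxP/(_ i j) := Fd s Js.
      have /is_derive_mxP/(_ i j) := Sd N s Js.
      move=> h1 h2; apply: is_derive_eq.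
      by rewrite subr0 mulmxBl !mxE.
    - by rewrite /f F0 St0 subrr subr0 mxE.
    - move=> s /=; rewrite in_itv/= => sab; rewrite expr0 mulr1.
      apply: mulmx_entry_bound; last exact: wW.
      by move=> k l; rewrite mx_subE; exact: ge.
  apply/eqP; rewrite -subr_eq0 -normr_le0 [(F t + _) i j]mxE.
  have lim0 : (fun N => e N.+1 + n%:R * e N * W * `|t - t0|) @ \oo --> 0.
    rewrite [X in _ --> X](_ : 0 = 0 + n%:R * 0 * W * `|t - t0|); last first.
      by rewrite mulr0 !mul0r addr0.
    apply: cvgD; first by rewrite (cvg_shiftS e).
    by apply: cvgMl; apply: cvgMl; apply: cvgMr.
  apply: (cvgr_to_ge lim0); near=> N.
  have -> : g t i j - (F t i j + 1%:M i j) = (g t i j - S N.+1 t i j) -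
    (F t i j + 1%:M i j - S N.+1 t i j) by ring.
  apply: (le_trans (ler_normB _ _)); apply: lerD.
    by apply: ge; case/andP: tab => /ltW -> /ltW ->.
  by move: (bnd N); rewrite expr1 divr1.
exists g; split; first by rewrite gF// F0 add0r.
move=> t Jt; apply: (@near_eq_is_derive _ _ _ (fun s => F s + 1%:M)).
  near=> s; have Js : J s by near: s; exact: open_nbhs_nbhs.
  by rewrite gF.
rewrite (_ : (fun s => _) = F + cst 1%:M)// -[X in is_derive _ _ _ X]addr0.
by apply: is_deriveD; exact: Fd.
Unshelve. all: by end_near. Qed.

Lemma is_derive0_constant (J : set R) (f : R -> R) a b : is_interval J ->
  J a -> J b -> (forall t, J t -> is_derive t 1 f 0) -> f a = f b.
Proof.
move=> iJ Ja Jb fd; have [l _] := @MVT_between _ J f (fun=> 0) a b iJ Ja Jb fd.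
by rewrite mul0r => /eqP; rewrite subr_eq0 => /eqP.
Qed.

Lemma linear_ode_SO (J : set R) (w g : R -> 'M[R]_n) t0 :
  is_interval J -> J t0 -> SO (g t0) -> (forall t, J t -> so (w t)) ->
  (forall t, J t -> is_derive t 1 g (g t *m w t)) ->
  forall t, J t -> SO (g t).
Proof.
move=> iJ J0 [g0 dg0] sw gd.
(* The product is taken in the order [g g^T] because its derivative is [g (w + w^T) g^T = 0]; that
   of [g^T g] would be a commutator with [w], not visibly zero. *)
have orth t : J t -> g t *m (g t)^T = 1%:M.
  move=> Jt; rewrite -(mulmx1C g0); apply/matrixP => i j.
  apply: (is_derive0_constant (J := J) (f := fun s => (g s *m (g s)^T) i j)) => // s Js.
  have /is_derive_mxP/(_ i j) := is_derive_mulmx (gd s Js)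
     (is_derive_linear_mx trmx (gd s Js)).
  by rewrite /= trmx_mul (sw s Js) mulNmx mulmxN -mulmxA subrr mxE.
have det2 t : J t -> \det (g t) ^+ 2 = 1.
  by move=> Jt; rewrite expr2 -{2}det_tr -det_mulmx orth// det1.
move=> t Jt; split; first by apply: mulmx1C; exact: orth.
have : \det (g t) == 1 \/ \det (g t) == -1.
  by apply/orP; rewrite -sqrf_eq1 det2.
case=> [/eqP//|/eqP dt].
have dc s : J s -> {for s, continuous (fun s => \det (g s))}.
  move=> Js; apply/differentiable_continuous/derivable1_diffP.
  by apply: derivable_det; case: (gd s Js).
have [c Jc dc0] : exists2 c, J c & \det (g c) = 0.
  have [tt0|t0t] := leP t t0.
    have [||c] := @IVT R (fun s => \det (g s)) t t0 0 tt0.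
    - apply: continuous_in_subspaceT => s; rewrite inE/= in_itv/= => h.
      exact/dc/(interval_sub iJ Jt J0).
    - by rewrite dt dg0 ge_min le_max lerN10 ler01 orbT.
    - by rewrite in_itv/= => h <-; exists c => //; exact: (interval_sub iJ Jt J0).
  have [||c] := @IVT R (fun s => \det (g s)) t0 t 0 (ltW t0t).
  - apply: continuous_in_subspaceT => s; rewrite inE/= in_itv/= => h.
    exact/dc/(interval_sub iJ J0 Jt).
  - by rewrite dt dg0 ge_min le_max lerN10 ler01 orbT.
  - by rewrite in_itv/= => h <-; exists c => //; exact: (interval_sub iJ J0 Jt).
by have := det2 c Jc; rewrite dc0 expr0n/= => /eqP; rewrite eq_sym oner_eq0.
Qed.

End LinearODE.

(** * Skew-symmetric matrices and the inertia operator *)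

Section SkewAlgebra.
Context {R : realType} {n : nat}.
Implicit Types (X Y : 'M[R]_n) (x y u : 'cV[R]_n) (g : 'M[R]_n).

Lemma so0 : so (0 : 'M[R]_n).
Proof. by rewrite /so/= trmx0 oppr0. Qed.

Lemma soD X Y : so X -> so Y -> so (X + Y).
Proof. by rewrite /so/= => sX sY; rewrite linearD/= sX sY opprD. Qed.

Lemma soN X : so X -> so (- X).
Proof. by rewrite /so/= => sX; rewrite linearN/= sX. Qed.

Lemma soB X Y : so X -> so Y -> so (X - Y).
Proof. by move=> sX sY; apply: soD => //; exact: soN. Qed.

Lemma soZ a X : so X -> so (a *: X).
Proof. by rewrite /so/= => sX; rewrite linearZ/= sX scalerN. Qed.

Lemma so_bracket X Y : so X -> so Y -> so (bracket X Y).
Proof.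
rewrite /so/bracket/= => sX sY; rewrite linearB/= !trmx_mul sX sY.
by rewrite !(mulNmx, mulmxN) !opprK opprB.
Qed.

Lemma so_symmetrized_tensor X x : so X -> so (X *m tensor x x + tensor x x *m X).
Proof.
rewrite /so/tensor/= => sX; rewrite linearD/= !trmx_mul !trmxK sX.
by rewrite mulmxN mulNmx addrC opprD.
Qed.

Lemma dotC x y : dot x y = dot y x.
Proof. by rewrite /dot -{2}[x]trmxK -trmx_mul [RHS]mxE. Qed.

Lemma dotZl a x y : dot (a *: x) y = a * dot x y.
Proof. by rewrite /dot linearZ/= -scalemxAl mxE. Qed.

Lemma dotZr a x y : dot x (a *: y) = a * dot x y.
Proof. by rewrite dotC dotZl dotC. Qed.

Lemma dot0r x : dot x 0 = 0.
Proof. by rewrite /dot mulmx0 mxE. Qed.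

Lemma dotNl x y : dot (- x) y = - dot x y.
Proof. by rewrite -scaleN1r dotZl mulN1r. Qed.

Lemma dot_mulmxr X x y : dot x (X *m y) = dot (X^T *m x) y.
Proof. by rewrite /dot trmx_mul trmxK mulmxA. Qed.

Lemma dot_mulmx_orthogonal g x y : g^T *m g = 1%:M -> dot (g *m x) (g *m y) = dot x y.
Proof. by move=> gg; rewrite dot_mulmxr mulmxA gg mul1mx. Qed.

Lemma dot_so X x : so X -> dot x (X *m x) = 0.
Proof.
move=> sX; have : dot x (X *m x) = - dot x (X *m x).
  rewrite {1}dot_mulmxr (sX : X^T = - X) mulNmx dotNl.
  by rewrite [in RHS]dotC.
by move/eqP; rewrite -addr_eq0 -mulr2n mulrn_eq0/= => /eqP.
Qed.

Lemma dot_ge0 x : 0 <= dot x x.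
Proof. by rewrite /dot mxE sumr_ge0// => i _; rewrite mxE -expr2 sqr_ge0. Qed.

Lemma mxtrace_tensor x y : \tr (tensor x y) = dot y x.
Proof. by rewrite /tensor mxtrace_mulC /mxtrace big_ord1. Qed.

Lemma pairingC X Y : pairing X Y = pairing Y X.
Proof. by rewrite /pairing mxtrace_mulC. Qed.

Lemma pairingDl X1 X2 Y : pairing (X1 + X2) Y = pairing X1 Y + pairing X2 Y.
Proof. by rewrite /pairing mulmxDl linearD/= mulrDr opprD. Qed.

Lemma pairingNl X Y : pairing (- X) Y = - pairing X Y.
Proof. by rewrite /pairing mulNmx linearN/= mulrN. Qed.

Lemma pairingBl X1 X2 Y : pairing (X1 - X2) Y = pairing X1 Y - pairing X2 Y.
Proof. by rewrite pairingDl pairingNl. Qed.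

Lemma pairingZl a X Y : pairing (a *: X) Y = a * pairing X Y.
Proof. by rewrite /pairing -scalemxAl mxtraceZ mulrCA mulrN. Qed.

Lemma pairingNr X Y : pairing X (- Y) = - pairing X Y.
Proof. by rewrite pairingC pairingNl pairingC. Qed.

Lemma pairingBr X Y1 Y2 : pairing X (Y1 - Y2) = pairing X Y1 - pairing X Y2.
Proof. by rewrite pairingC pairingBl ![pairing _ X]pairingC. Qed.

Lemma pairing0l Y : pairing 0 Y = 0.
Proof. by rewrite /pairing mul0mx mxtrace0 mulr0 oppr0. Qed.

(** Invariance of the trace form under the adjoint action, from cyclicity of the trace. *)
Lemma pairing_bracket X Y Z : pairing X (bracket Y Z) = - pairing (bracket X Z) Y.
Proof.
rewrite /pairing /bracket mulmxBr mulmxBl !raddfB/= !mulmxA.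
by rewrite [\tr (X *m Y *m Z)]mxtrace_mulC mulmxA opprK -mulrN opprB.
Qed.

(** The left entry is the wedge product of [u] and [x]. This identity carries the translational
    terms, which are dot products in space, over to the dual of so(n). *)
Lemma dot_so_pairing X u x : so X ->
  dot u (X *m x) = pairing (tensor u x - tensor x u) X.
Proof.
move=> sX; rewrite /pairing mulmxBl linearB/=.
have E y z : \tr (tensor y z *m X) = dot z (X *m y).
  by rewrite mxtrace_mulC -mxtrace_tensor /tensor mulmxA.
rewrite !E [dot x _]dot_mulmxr (sX : X^T = - X) mulNmx dotNl.
by rewrite [dot (X *m x) u]dotC; field.
Qed.

(** For skew [X] the pairing is half the sum of the squared entries. *)
Lemma pairing_self_eq0 X : so X -> pairing X X = 0 -> X = 0.
Proof.
move=> sX; rewrite /pairing => /eqP; rewrite oppr_eq0 mulf_eq0 invr_eq0 pnatr_eq0/=.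
have -> : \tr (X *m X) = - \tr (X *m X^T).
  by rewrite (sX : X^T = - X) mulmxN linearN/= opprK.
rewrite oppr_eq0 /mxtrace psumr_eq0; last first.
  by move=> i _; rewrite mxE sumr_ge0// => j _; rewrite mxE -expr2 sqr_ge0.
move=> /allP X0; apply/matrixP => i j; apply/eqP.
have := X0 i (mem_index_enum _); rewrite /= mxE psumr_eq0; last first.
  by move=> k _; rewrite mxE -expr2 sqr_ge0.
by move/allP/(_ j (mem_index_enum _)); rewrite /= !mxE -expr2 sqrf_eq0.
Qed.

Lemma SO_unitmx g : SO g -> g \in unitmx.
Proof. by case=> gg _; case: (mulmx1_unit gg). Qed.

Lemma SO_invmx g : SO g -> invmx g = g^T.
Proof.
move=> sg; have gu := SO_unitmx sg; case: sg => gg _.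
by rewrite -[LHS]mul1mx -gg mulmxK.
Qed.

Lemma SO1 : SO (1%:M : 'M[R]_n).
Proof. by split; rewrite ?trmx1 ?mulmx1 ?det1. Qed.

Lemma SO_mulmx g h : SO g -> SO h -> SO (g *m h).
Proof.
move=> [gg dg] [hh dh]; split; last by rewrite det_mulmx dg dh mulr1.
by rewrite trmx_mul mulmxA -[_ *m g^T *m g]mulmxA gg mulmx1.
Qed.

Lemma SO_trmx g : SO g -> SO g^T.
Proof. by move=> [gg dg]; split; rewrite ?det_tr// trmxK; exact: mulmx1C. Qed.

Lemma SO_invmx_mulKmx a g p (X : 'M[R]_(n, p)) : SO a -> SO g ->
  invmx (a *m g) *m (a *m X) = invmx g *m X.
Proof.
move=> sa sg; rewrite !SO_invmx//; last exact: SO_mulmx.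
by rewrite trmx_mul -mulmxA [a^T *m _]mulmxA; case: sa => -> _; rewrite mul1mx.
Qed.

End SkewAlgebra.

(** * Positivity of [kappa] and regularity of its inverse *)

Section Inertia.
Context {R : realType} {n : nat} (rho m : R) (I : {linear 'M[R]_n -> 'M[R]_n}).
Context (m_gt0 : 0 < m) (hI : inertia_tensor I).
Implicit Types (X Y w : 'M[R]_n) (x : 'cV[R]_n).

Lemma kappa_so x w : so w -> so (kappa rho m I x w).
Proof.
case: hI => Iso _ _ sw; apply: soD; first exact: Iso.
by apply: soZ; exact: so_symmetrized_tensor.
Qed.

Lemma kappaD x X Y : kappa rho m I x (X + Y) = kappa rho m I x X + kappa rho m I x Y.
Proof.
by rewrite /kappa linearD/= mulmxDl mulmxDr [in LHS]addrACA scalerDr addrACA.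
Qed.

Lemma kappaZ x a X : kappa rho m I x (a *: X) = a *: kappa rho m I x X.
Proof.
rewrite /kappa linearZ/= -scalemxAl -scalemxAr -scalerDr [in RHS]scalerDr.
by rewrite !scalerA [a * _]mulrC.
Qed.

(** As [w] is skew, the symmetrized tensor is the wedge product of [w x] and [x]. The rolling term
    of [kappa] thus adds [m rho^2 |w x|^2] to the inertia form, which keeps [kappa] positive
    definite on so(n). *)
Lemma pairing_symmetrized_tensor x w : so w ->
  pairing (w *m tensor x x + tensor x x *m w) w = dot (w *m x) (w *m x).
Proof.
move=> sw; rewrite dot_so_pairing//; congr (pairing _ w).
rewrite /tensor trmx_mul (sw : w^T = - w) mulmxN mulmxN opprK !mulmxA.
by [].
Qed.

Lemma kappa_eq0 x w : so w -> kappa rho m I x w = 0 -> w = 0.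
Proof.
case: hI => _ _ Ipos sw k0; apply/eqP/negPn/negP => w0.
have : pairing (kappa rho m I x w) w = 0 by rewrite k0 pairing0l.
rewrite pairingDl pairingZl pairing_symmetrized_tensor// => /eqP.
rewrite gt_eqF// ltr_wpDr ?Ipos// mulr_ge0 ?dot_ge0//.
by rewrite mulr_ge0 ?sqr_ge0 ?ltW.
Qed.

Definition skew_part X : 'M[R]_n := 2^-1 *: (X - X^T).
Definition sym_part X : 'M[R]_n := 2^-1 *: (X + X^T).

Lemma skew_part_so X : so (skew_part X).
Proof. by rewrite /so/skew_part/= linearZ linearB/= trmxK -scalerN opprB. Qed.

Lemma skew_sym_part X : skew_part X + sym_part X = X.
Proof.
by apply/matrixP => i j; rewrite !mxE; field.
Qed.

(* Extending [kappa x] by the identity on symmetric matrices gives an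
   automorphism of the whole matrix space, whose inverse is [invmx] of a matrix
   depending smoothly on [x]. *)
Definition kappa_ext x X := kappa rho m I x (skew_part X) + sym_part X.

Lemma kappa_ext_is_linear x : linear (kappa_ext x).
Proof.
move=> a X Y; rewrite /kappa_ext.
have -> : skew_part (a *: X + Y) = a *: skew_part X + skew_part Y.
  by rewrite /skew_part linearD linearZ/=; apply/matrixP => i j; rewrite !mxE; ring.
have -> : sym_part (a *: X + Y) = a *: sym_part X + sym_part Y.
  by rewrite /sym_part linearD linearZ/=; apply/matrixP => i j; rewrite !mxE; ring.
by rewrite kappaD kappaZ addrACA -scalerDr.
Qed.

HB.instance Definition _ x :=
  GRing.isLinear.Build R 'M[R]_n 'M[R]_n _ (kappa_ext x) (kappa_ext_is_linear x).

Definition kappa_mx x : 'M[R]_(n * n) := lin_mx (kappa_ext x).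

Lemma sym_part_so_eq0 X : so (sym_part X) -> sym_part X = 0.
Proof.
move=> s; have : (sym_part X)^T = sym_part X.
  by rewrite /sym_part linearZ linearD/= trmxK addrC.
rewrite (s : _^T = - _) => /eqP; rewrite eq_sym -addr_eq0 -mulr2n.
by rewrite -scaler_nat scaler_eq0 pnatr_eq0/= => /eqP.
Qed.

(** A skew value leaves [sym_part X] both symmetric and skew, hence zero. So the inverse of
    [kappa_ext x] preserves so(n) and inverts [kappa] there. *)
Lemma kappa_ext_so x X : so (kappa_ext x X) -> so X /\ kappa_ext x X = kappa rho m I x X.
Proof.
move=> s; have : so (sym_part X).
  have -> : sym_part X = kappa_ext x X - kappa rho m I x (skew_part X).
    by rewrite /kappa_ext addrC addKr.
  apply: soB => //; apply: kappa_so; exact: skew_part_so.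
move/sym_part_so_eq0 => s0; have XE := skew_sym_part X.
rewrite s0 addr0 in XE; split; first by rewrite -XE; exact: skew_part_so.
by rewrite /kappa_ext s0 addr0 XE.
Qed.

Lemma kappa_mx_unit x : kappa_mx x \in unitmx.
Proof.
rewrite -row_free_unit -kermx_eq0; apply/rowV0P => v /sub_kermxP.
rewrite -[v]vec_mxK /kappa_mx mul_vec_lin/= => /eqP.
rewrite mxvec_eq0 => /eqP v0.
(* The image 0 of a kernel vector is skew, so the vector lies in so(n), where [kappa] is
   injective. *)
have [sv kv] : so (vec_mx v) /\ _ := @kappa_ext_so x (vec_mx v) (eq_rect_r _ so0 v0).
by rewrite (@kappa_eq0 x (vec_mx v)) ?linear0// -kv.
Qed.

Definition kappa_solve x Y : 'M[R]_n := vec_mx (mxvec Y *m invmx (kappa_mx x)).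

Lemma kappa_solveK x Y : so Y ->
  so (kappa_solve x Y) /\ kappa rho m I x (kappa_solve x Y) = Y.
Proof.
move=> sY.
have E : kappa_ext x (kappa_solve x Y) = Y.
  apply: (can_inj mxvecK); rewrite -mul_vec_lin/= /kappa_solve vec_mxK.
  by rewrite mulmxKV// kappa_mx_unit.
have sE : so (kappa_ext x (kappa_solve x Y)) by rewrite E.
by have [s k] := kappa_ext_so sE; split=> //; rewrite -k.
Qed.

Lemma kappa_inj x : {in @so R n &, injective (kappa rho m I x)}.
Proof.
move=> X Y /set_mem sX /set_mem sY kXY.
apply/eqP; rewrite -subr_eq0; apply/eqP; apply: (@kappa_eq0 x); first exact: soB.
by rewrite kappaD -scaleN1r kappaZ scaleN1r kXY subrr.
Qed.

Lemma kappa_bij x : set_bij (@so R n) (@so R n) (kappa rho m I x).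
Proof.
split; [by move=> X; exact: kappa_so | exact: kappa_inj |].
by move=> Y sY; have [s k] := kappa_solveK x sY; exists (kappa_solve x Y).
Qed.

Lemma kappa_invK x w : so w -> kappa_inv rho m I x (kappa rho m I x w) = w.
Proof.
move=> /mem_set sw; exact: (@pinvKV _ _ (fun=> 0) _ _ (@kappa_inj x) w sw).
Qed.

(** Replaces an inverse known only by its defining property with a formula that can be
    differentiated in [x] and [Y]. *)
Lemma kappa_invE x Y : so Y -> kappa_inv rho m I x Y = kappa_solve x Y.
Proof.
by move=> sY; have [s k] := kappa_solveK x sY; rewrite -{1}k kappa_invK.
Qed.

Lemma is_derive_kappa (x : R -> 'cV[R]_n) (w : R -> 'M[R]_n) (t : R) dx dw :
  is_derive t 1 x dx -> is_derive t 1 w dw ->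
  is_derive t 1 (fun s => kappa rho m I (x s) (w s))
    (kappa rho m I (x t) dw + (m * rho ^+ 2) *:
      (w t *m (tensor dx (x t) + tensor (x t) dx) +
       (tensor dx (x t) + tensor (x t) dx) *m w t)).
Proof.
move=> xd wd.
have pd := is_derive_mulmx xd (is_derive_linear_mx trmx xd).
have h1 := is_derive_linear_mx I wd.
have h2 := is_derive_mulmx wd pd.
have h3 := is_derive_mulmx pd wd.
have h := is_deriveD h1 (is_deriveZ (m * rho ^+ 2) (is_deriveD h2 h3)).
apply: (is_derive_eq h); rewrite /kappa/=.
by apply/matrixP => i j; rewrite /tensor !mulmxDr !mulmxDl !mxE; ring.
Qed.

Lemma derivable_kappa_solve (x : R -> 'cV[R]_n) (k : R -> 'M[R]_n) (t : R) :
  derivable x t 1 -> derivable k t 1 ->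
  derivable (fun s => kappa_solve (x s) (k s)) t 1.
Proof.
move=> xd kd.
have md : derivable (fun s => kappa_mx (x s)) t 1.
  apply/derivable_mxP => i j.
  (* Row [i] of the matrix is the flattened image of the [i]-th elementary matrix, and it depends on
     [x s] only through [tensor (x s) (x s)]. *)
  rewrite (_ : (fun s => _) =
      fun s => mxvec (kappa_ext (x s) (vec_mx (delta_mx 0 i))) 0 j); last first.
    by apply/funext => s; rewrite /kappa_mx /lin_mx mxE.
  have h := is_derive_kappa (derivableP xd)
    (is_derive_cst (skew_part (vec_mx (delta_mx 0 i))) t 1).
  have h' : is_derive t 1 (fun s => kappa_ext (x s) (vec_mx (delta_mx 0 i))) _ :=
    is_deriveD h (is_derive_cst (sym_part (vec_mx (delta_mx 0 i))) t 1).
  by have /is_derive_mxP/(_ 0 j)[] := is_derive_linear_mx mxvec h'.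
have h := is_derive_linear_mx mxvec (derivableP kd).
have h2 := is_derive_mulmx h (is_derive_invmx (derivableP md) (kappa_mx_unit (x t))).
by have [] := is_derive_linear_mx vec_mx h2.
Qed.

End Inertia.

(** * Mechanics of the rolling ball *)

Section Lagrangian.
Context {R : realType} {n : nat} (m : R) (I : {linear 'M[R]_n -> 'M[R]_n}).
Local Notation ambient := ('M[R]_n * 'cV[R]_n)%type.
Implicit Types (q v : R -> ambient).

Lemma is_derive_unique (V : normedModType R) (f : R -> V) (t : R) a b :
  is_derive t 1 f a -> is_derive t 1 f b -> a = b.
Proof. by case=> _ <- [_ <-]. Qed.

Lemma is_derive_const (V : normedModType R) (a : V) (t : R) :
  is_derive t 1 (fun=> a) 0.
Proof. exact: is_derive_cst. Qed.

Lemma is_derive_so (J : set R) (X : R -> 'M[R]_n) (t : R) dX : open J -> J t ->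
  (forall s, J s -> so (X s)) -> is_derive t 1 X dX -> so dX.
Proof.
move=> oJ Jt sX Xd; have h := is_derive_linear_mx trmx Xd.
have h0 : is_derive t 1 (- X) dX^T.
  apply: near_eq_is_derive h; near=> s.
  by have /sX : J s by near: s; exact: open_nbhs_nbhs.
exact: is_derive_unique h0 (is_deriveN Xd).
Unshelve. all: by end_near. Qed.

Lemma is_derive_pairing (A B : R -> 'M[R]_n) (t : R) dA dB :
  is_derive t 1 A dA -> is_derive t 1 B dB ->
  is_derive t 1 (fun s => pairing (A s) (B s))
    (pairing dA (B t) + pairing (A t) dB).
Proof.
move=> Ad Bd; have h := is_derive_mxtrace (is_derive_mulmx Ad Bd).
have h' := is_deriveN (is_deriveZ (2^-1) h).
by apply: (is_derive_eq h'); rewrite mxtraceD scalerDr opprD.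
Qed.

Lemma is_derive_dot (x y : R -> 'cV[R]_n) (t : R) dx dy :
  is_derive t 1 x dx -> is_derive t 1 y dy ->
  is_derive t 1 (fun s => dot (x s) (y s)) (dot dx (y t) + dot (x t) dy).
Proof.
move=> xd yd; have h := is_derive_mulmx (is_derive_linear_mx trmx xd) yd.
by have /is_derive_mxP/(_ 0 0) := h; rewrite mxE.
Qed.

(** Position and velocity vary independently, so that freezing either one gives a partial
    derivative. The two pairings are kept apart because [dw] and [omega] need not be skew here, and
    [I] is symmetric only on so(n). *)
Lemma is_derive_lagrangian q v (t : R) dw dv :
  is_derive t 1 (fun s => omega (q s) (v s)) dw ->
  is_derive t 1 (fun s => (v s).2) dv ->
  is_derive t 1 (fun s => lagrangian m I (q s) (v s))
    (2^-1 * (pairing (I dw) (omega (q t) (v t)) + pairing (I (omega (q t) (v t))) dw)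
     + m * dot (v t).2 dv).
Proof.
move=> wd vd.
have h1 := is_deriveZ (2^-1) (is_derive_pairing (is_derive_linear_mx I wd) wd).
have h2 := is_deriveZ (2^-1 * m) (is_derive_dot vd vd).
apply: (is_derive_eq (is_deriveD h1 h2)).
by rewrite [dot dv _]dotC /GRing.scale/=; field.
Qed.

Lemma is_derive_affine (V : normedModType R) (a d : V) (t : R) :
  is_derive t 1 (fun h : R => h *: d + a) d.
Proof.
apply/is_derive1P; apply: cvg_near_cst; near=> h.
rewrite opprD addrACA subrr addr0 -scalerBl addrK scalerA mulVf ?scale1r//.
by near: h; exact: nbhs_dnbhs_neq.
Unshelve. all: by end_near. Qed.

Lemma derive_lagrangian_velocity (q v d : ambient) :
  'D_d (lagrangian m I q) v =
  2^-1 * (pairing (I (omega q d)) (omega q v) + pairing (I (omega q v)) (omega q d))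
  + m * dot v.2 d.2.
Proof.
rewrite derive_line.
have [h1 h2] := (is_derive_pairP _ _ _).1 (is_derive_affine v d 0).
have h3 := is_derive_mulmx (is_derive_const (invmx q.1) 0) h1.
have [_ ->] := @is_derive_lagrangian (fun=> q) _ 0 _ _ h3 h2.
by rewrite /= !scale0r !add0r mul0mx add0r.
Qed.

(** With [v] fixed, moving [g] along [d] changes [g^-1 v.1] by [- omega q d *m omega q v]; the
    translational energy does not depend on the position. *)
Lemma derive_lagrangian_position (q v d : ambient) : q.1 \in unitmx ->
  'D_d (fun x => lagrangian m I x v) q =
  - (2^-1 * (pairing (I (omega q d *m omega q v)) (omega q v) +
             pairing (I (omega q v)) (omega q d *m omega q v))).
Proof.
move=> qu; rewrite derive_line.
have [h1 _] := (is_derive_pairP _ _ _).1 (is_derive_affine q d 0).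
have qu0 : (0 *: d + q).1 \in unitmx by rewrite scale0r add0r.
have h3 := is_derive_mulmx (is_derive_invmx h1 qu0) (is_derive_const v.1 0).
have [_ ->] := @is_derive_lagrangian _ (fun=> v) 0 _ _ h3 (is_derive_const v.2 0).
rewrite /= !scale0r !add0r mulmx0 addr0 dot0r.
rewrite mulr0 addr0 mulNmx linearN pairingNl pairingNr -opprD mulrN.
by rewrite /omega !mulmxA.
Qed.

(* [omega (q s) d] is skew only at [s = t], and [I] is unconstrained off so(n),
   but the non-skew parts of the two terms of the Euler-Lagrange covector
   cancel, so that [I] is eventually applied to [bracket xi w] only. *)
Lemma euler_lagrange_lagrangian (J : set R) q (t : R) (dw : 'M[R]_n) (dv : ambient) d :
  inertia_tensor I -> open J -> J t ->
  (forall s, J s -> (q s).1 \in unitmx) ->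
  derivable q t 1 -> is_derive t 1 ('D_1 q) dv ->
  is_derive t 1 (fun s => omega (q s) ('D_1 q s)) dw ->
  so (omega (q t) ('D_1 q t)) -> so dw -> so (omega (q t) d) ->
  euler_lagrange (lagrangian m I) q t d =
  pairing (I dw - bracket (I (omega (q t) ('D_1 q t))) (omega (q t) ('D_1 q t)))
    (omega (q t) d) + m * dot dv.2 d.2.
Proof.
move=> hI oJ Jt qu qd /is_derive_pairP[_ vd] wd sw sdw sxi.
have [gd _] := (is_derive_pairP _ _ _).1 (derivableP qd).
rewrite /euler_lagrange derive_lagrangian_position; last exact: qu.
set w := omega (q t) _ in sw *; set xi := omega (q t) d in sxi *.
rewrite (_ : (fun s => 'D_d (lagrangian m I (q s)) ('D_1 q s)) = fun s =>
  2^-1 * (pairing (I (omega (q s) d)) (omega (q s) ('D_1 q s)) +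
  pairing (I (omega (q s) ('D_1 q s))) (omega (q s) d)) + m * dot ('D_1 q s).2 d.2);
  last by apply/funext => s; exact: derive_lagrangian_velocity.
have xid : is_derive t 1 (fun s => omega (q s) d) (- (w *m xi)).
  have := is_derive_mulmx (is_derive_invmx gd (qu t Jt)) (is_derive_const d.1 t).
  by rewrite mulmx0 addr0 mulNmx /w /xi /omega !mulmxA.
have h1 := is_derive_pairing (is_derive_linear_mx I xid) wd.
have h2 := is_derive_pairing (is_derive_linear_mx I wd) xid.
have h3 := is_derive_dot vd (is_derive_const d.2 t).
have [_ ->] := is_deriveD (is_deriveZ (2^-1) (is_deriveD h1 h2)) (is_deriveZ m h3).
rewrite dot0r addr0 /GRing.scale/= -/w -/xi.
case: hI => Iso Isym _.
have E1 := Isym _ _ (so_bracket sxi sw) sw.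
rewrite [RHS]pairingC pairing_bracket {1}/bracket linearB/= pairingBl in E1.
have E2 := pairing_bracket (I w) xi w; rewrite {1}/bracket pairingBr in E2.
have E3 := Isym _ _ sxi sdw; rewrite [RHS]pairingC in E3.
rewrite E3 !linearN /= pairingNl pairingNr pairingBl.
move: E1 E2.
set e := pairing (bracket (I w) w) xi.
set M := m * _.
set a1 := pairing (I (xi *m w)) w; set a2 := pairing (I (w *m xi)) w.
set b1 := pairing (I w) (xi *m w); set b2 := pairing (I w) (w *m xi).
set f := pairing (I dw) xi.
clearbody e M a1 a2 b1 b2 f => E1 E2.
by lra.
Qed.

End Lagrangian.

(** * The no-slip distribution and the equation for the momentum *)

Section Mechanics.
Context {R : realType} {n : nat} (c : rolling_case) (sigma rho m : R)
  (I : {linear 'M[R]_n -> 'M[R]_n}).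
Context (sigma_gt0 : 0 < sigma) (rho_gt0 : 0 < rho) (m_gt0 : 0 < m)
  (hc : admissible c sigma rho) (hI : inertia_tensor I).
Local Notation ambient := ('M[R]_n * 'cV[R]_n)%type.
Local Notation radius := (center_radius c sigma rho).
Local Notation eps := (epsilon c sigma rho).
Local Notation gam := (gamma c sigma rho).
Local Notation noslip := (noslip_distribution c sigma rho).
Implicit Types (g w a : 'M[R]_n) (x : 'cV[R]_n).

Lemma radius_neq0 : radius != 0.
Proof.
move: hc; rewrite /center_radius; case: c => /= h.
- by rewrite mul1r gt_eqF// addr_gt0.
- by rewrite mulN1r subr_eq0 gt_eqF.
- by rewrite mulN1r subr_eq0 lt_eqF.
Qed.

Lemma pm_sqr : pm R c ^+ 2 = 1.
Proof. by case: c; rewrite /= ?sqrrN expr1n. Qed.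

(** This is the coefficient of [w x] in [x'] for [x = g^-1 r / radius]: the no-slip velocity of [r]
    gives the first term, the rotation of the body frame gives [-1]. *)
Lemma epsilonE : radius^-1 * (pm R c * rho) - 1 = - eps.
Proof.
have := radius_neq0; rewrite /epsilon /center_radius => r0.
by field.
Qed.

(** The inverse of the chart [(omega, g, gamma)] on the distribution; the last component is the
    no-slip velocity, as [Ad g w] applied to [g x] is [g w x]. *)
Definition state g w x : ambient * ambient :=
  ((g, radius *: (g *m x)), (g *m w, (pm R c * rho) *: (g *m (w *m x)))).

Lemma omega_state g w x : SO g -> omega (state g w x).1 (state g w x).2 = w.
Proof. by move=> sg; rewrite /omega/= mulKmx// SO_unitmx. Qed.

Lemma gamma_state g w x : SO g -> gam (state g w x).1 = x.
Proof.
move=> sg; rewrite /gamma /Gamma/= scalerA mulVf ?radius_neq0// scale1r.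
by rewrite mulKmx// SO_unitmx.
Qed.

Lemma noslip_state g w x : SO g -> so w -> sphere x -> noslip (state g w x).
Proof.
move=> sg sw sx; split; last first.
  rewrite omega_state// /Ad /Gamma/= scalerA mulVf ?radius_neq0// scale1r.
  by rewrite -!mulmxA mulKmx// SO_unitmx.
have gg : g^T *m g = 1%:M by case: sg.
split.
- split=> //=; rewrite dotZl dotZr dot_mulmx_orthogonal//.
  by rewrite (sx : dot x x = 1) mulr1 expr2.
- by rewrite omega_state.
- by rewrite /= dotZl dotZr dot_mulmx_orthogonal// dot_so// !mulr0.
Qed.

Lemma noslipE (s : ambient * ambient) : noslip s -> [/\ SO s.1.1, so (omega s.1 s.2),
  sphere (gam s.1) & s = state s.1.1 (omega s.1 s.2) (gam s.1)].
Proof.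
case: s => -[g r] [v u] [[[/= sg rr] sw _] /= uE].
have gu := SO_unitmx sg.
have gx : g *m gam (g, r) = radius^-1 *: r by rewrite /gamma /Gamma/= mulKVmx.
split=> //.
  have [gg _] := sg.
  rewrite /sphere/= -(dot_mulmx_orthogonal _ _ gg) gx dotZl dotZr rr.
  by have := radius_neq0 => r0; field.
rewrite /state gx scalerA divff ?radius_neq0// scale1r.
rewrite {2}/omega/= mulKVmx// uE /Ad /gamma -!mulmxA.
by [].
Qed.

Lemma act_state a g w x : lifted_act a (state g w x) = state (a *m g) w x.
Proof. by rewrite /lifted_act /act /state/= -!scalemxAr !mulmxA. Qed.

(** With [P = tensor x x], both sides contain [dw P + P dw] and [(1 - eps) (w w P - P w w)]. On the
    right, the 1 comes from the bracket and [- eps] from the motion of [x], while the products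
    [w P w] cancel. *)
Lemma momentum_balance w dw x dx :
  so w -> so dw -> dx = - eps *: (w *m x) ->
  let u := w *m (w *m x) + dw *m x + w *m dx in
  I dw - bracket (I w) w + (m * rho ^+ 2) *: (tensor u x - tensor x u) =
  (kappa rho m I x dw + (m * rho ^+ 2) *: (w *m (tensor dx x + tensor x dx) +
       (tensor dx x + tensor x dx) *m w)) - bracket (kappa rho m I x w) w.
Proof.
move=> sw sdw -> /=.
have Tl (A : 'M[R]_n) y z : tensor (A *m y) z = A *m tensor y z.
  by rewrite /tensor mulmxA.
have Tr (A : 'M[R]_n) y z : tensor y (A *m z) = tensor y z *m A^T.
  by rewrite /tensor trmx_mul mulmxA.
have TDl y1 y2 z : tensor (y1 + y2) z = tensor y1 z + tensor y2 z :> 'M[R]_n.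
  by rewrite /tensor mulmxDl.
have TDr y1 y2 z : tensor z (y1 + y2) = tensor z y1 + tensor z y2 :> 'M[R]_n.
  by rewrite /tensor linearD mulmxDr.
have TZl b y z : tensor (b *: y) z = b *: tensor y z :> 'M[R]_n.
  by rewrite /tensor scalemxAl.
have TZr b y z : tensor z (b *: y) = b *: tensor z y :> 'M[R]_n.
  by rewrite /tensor linearZ scalemxAr.
rewrite /kappa /bracket -!scalemxAr !(TDl, TDr, TZl, TZr, Tl, Tr).
rewrite (sw : w^T = - w) (sdw : dw^T = - dw).
set P := tensor x x.
rewrite !(mulmxN, mulNmx, mulmxDl, mulmxDr, opprK).
rewrite -!scalemxAl -!scalemxAr !(mulmxN, mulNmx, mulmxDl, mulmxDr, opprK) !mulmxA.
apply/matrixP => i j.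
rewrite ![in LHS]mxE ![in RHS]mxE.
by ring.
Qed.

Local Notation ang q := (fun t => omega (q t) ('D_1 q t)).
Local Notation momentum q :=
  (fun t => kappa rho m I (gam (q t)) (omega (q t) ('D_1 q t))).

Lemma is_derive_gamma (q : R -> ambient) (t : R) : derivable q t 1 ->
  noslip (q t, 'D_1 q t) ->
  is_derive t 1 (fun s => gam (q s)) (- eps *: (ang q t *m gam (q t))).
Proof.
move=> qd D; have [gd rd] := (is_derive_pairP _ _ _).1 (derivableP qd).
have [/= sg sw sx E] := noslipE D.
have h := is_derive_mulmx (is_derive_invmx gd (SO_unitmx sg)) (is_deriveZ radius^-1 rd).
have vE := congr1 (fun s : ambient * ambient => s.2.2) E; rewrite /= in vE.
apply: (is_derive_eq h).
rewrite -epsilonE scalerBl scale1r addrC; congr (_ + _).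
  by rewrite vE scalerA -scalemxAr mulKmx ?SO_unitmx.
by rewrite mulNmx /gamma /omega !mulmxA.
Qed.

Lemma noslip_dynamics (J : set R) (q : R -> ambient) (t : R) : open J -> J t ->
  (forall s, J s -> derivable q s 1 /\ noslip (q s, 'D_1 q s)) ->
  derivable ('D_1 q) t 1 ->
  exists dK, [/\ is_derive t 1 (momentum q) dK, so dK &
    forall d, noslip (q t, d) -> euler_lagrange (lagrangian m I) q t d =
      pairing (dK - bracket (momentum q t) (ang q t)) (omega (q t) d)].
Proof.
move=> oJ Jt qD vd.
have sD s : J s -> [/\ SO (q s).1, so (ang q s), sphere (gam (q s)) &
    (q s, 'D_1 q s) = state (q s).1 (ang q s) (gam (q s))].
  by move=> Js; have [_ /noslipE] := qD s Js.
have [qd Dt] := qD t Jt; have [sg sw sx E] := sD t Jt.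
have [gd rd] := (is_derive_pairP _ _ _).1 (derivableP qd).
have [v1d v2d] := (is_derive_pairP _ _ _).1 (derivableP vd).
have xd := is_derive_gamma qd Dt.
have [dw wd] : exists dw, is_derive t 1 (ang q) dw.
  by eexists; exact: (is_derive_mulmx (is_derive_invmx gd (SO_unitmx sg)) v1d).
have sdw : so dw by apply: (is_derive_so oJ Jt) wd => s /sD[].
have Kd := is_derive_kappa rho m I xd wd.
eexists; split; first exact: Kd.
  by apply: (is_derive_so oJ Jt) Kd => s /sD[_ sws _ _]; exact: kappa_so.
move=> d Dd; have [/= _ sxi _ Ed] := noslipE Dd.
rewrite (euler_lagrange_lagrangian m hI oJ Jt _ qd (derivableP vd) wd sw sdw sxi);
  last by move=> s /sD[/SO_unitmx].
pose w := omega (q t) ('D_1 q t); pose x := gam (q t); pose xi := omega (q t) d.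
pose dx := - eps *: (w *m x).
have gE : ('D_1 q t).1 = (q t).1 *m w.
  exact: (congr1 (fun s : ambient * ambient => s.2.1) E).
have v2E : ('D_1 ('D_1 q) t).2 = (pm R c * rho) *:
    ((q t).1 *m (w *m (w *m x) + dw *m x + w *m dx)).
  (* The constraint holds at all times near [t], so the acceleration of the center is the derivative
     of [pm rho g w x]. *)
  have h := is_deriveZ (pm R c * rho)
    (is_derive_mulmx gd (is_derive_mulmx wd xd)).
  apply: (is_derive_unique v2d).
  apply: (@near_eq_is_derive _ _ _
    (fun s => (pm R c * rho) *: ((q s).1 *m (ang q s *m gam (q s))))).
    near=> s; have /sD[_ _ _ Es] : J s by near: s; exact: open_nbhs_nbhs.
    exact: esym (congr1 (fun s : ambient * ambient => s.2.2) Es).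
  apply: (is_derive_eq h); congr (_ *: _).
  by rewrite gE -mulmxA -mulmxDr addrA.
have d2E : d.2 = (pm R c * rho) *: ((q t).1 *m (xi *m x)).
  exact: (congr1 (fun s : ambient * ambient => s.2.2) Ed).
rewrite v2E d2E dotZl dotZr dot_mulmx_orthogonal; last by case: sg.
(* The velocity of the center and the test direction each carry a factor [pm rho]; the sign
   disappears in the product. *)
have mE (y : R) : m * (pm R c * rho * (pm R c * rho * y)) = m * rho ^+ 2 * y.
  by rewrite -[m * rho ^+ 2]mulr1 -(pm_sqr); ring.
rewrite mE dot_so_pairing//.
rewrite -pairingZl -pairingDl; congr (pairing _ _).
exact: momentum_balance.
Unshelve. all: by end_near. Qed.

Lemma motionP (J : set R) (q : R -> ambient) : open J ->
  motion c sigma rho m I J q <->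
  forall t, J t -> [/\ derivable q t 1, derivable ('D_1 q) t 1,
    noslip (q t, 'D_1 q t) &
    is_derive t 1 (momentum q) (bracket (momentum q t) (ang q t))].
Proof.
move=> oJ; split=> H t Jt.
  have [dq dv D EL] := H t Jt; split=> //.
  have [|dK [Kd sdK ELE]] := noslip_dynamics oJ Jt _ dv.
    by move=> s /H[].
  have [sg sw sx E] := noslipE D.
  apply: (is_derive_eq Kd); apply/eqP; rewrite -subr_eq0; apply/eqP.
  have s0 : so (dK - bracket (momentum q t) (ang q t)).
    by apply: soB => //; apply: so_bracket => //; exact: kappa_so.
  apply: pairing_self_eq0 => //.
  (* The test direction is the one whose [xi] is the residual [k' - [k, w]] itself, so the equation
     says that the residual has zero pairing with itself. *)
  pose d := (state (q t).1 (dK - bracket (momentum q t) (ang q t)) (gam (q t))).2.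
  have Dd : noslip (q t, d).
    have qE : q t = (state (q t).1 (dK - bracket (momentum q t) (ang q t))
       (gam (q t))).1 by exact: (congr1 fst E).
    by rewrite qE /d -surjective_pairing; exact: noslip_state.
  have dE : omega (q t) d = dK - bracket (momentum q t) (ang q t).
    by rewrite [LHS]mulKmx// SO_unitmx.
  by have := ELE d Dd; rewrite EL// dE => /esym.
have [dq dv D KE] := H t Jt; split=> // d Dd.
have [|dK [Kd sdK ->//]] := noslip_dynamics oJ Jt _ dv.
  by move=> s /H[].
by rewrite (is_derive_unique Kd KE) subrr pairing0l.
Qed.

End Mechanics.

(** * Correspondence between motions and solutions, reconstruction, symmetry *)

Section Equations.
Context {R : realType} {n : nat} (c : rolling_case) (sigma rho m : R)
  (I : {linear 'M[R]_n -> 'M[R]_n}).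
Context (sigma_gt0 : 0 < sigma) (rho_gt0 : 0 < rho) (m_gt0 : 0 < m)
  (hc : admissible c sigma rho) (hI : inertia_tensor I).
Local Notation ambient := ('M[R]_n * 'cV[R]_n)%type.
Local Notation radius := (center_radius c sigma rho).
Local Notation eps := (epsilon c sigma rho).
Local Notation gam := (gamma c sigma rho).
Local Notation noslip := (noslip_distribution c sigma rho).
Local Notation state := (state c sigma rho).
Local Notation noslipE := (noslipE sigma_gt0 rho_gt0 hc).
Local Notation motionP := (motionP m sigma_gt0 rho_gt0 hc hI).

Lemma phase_point_state (g w : 'M[R]_n) (x : 'cV[R]_n) : SO g ->
  phase_point c sigma rho m I (state g w x) = (kappa rho m I x w, g, x).
Proof. by move=> sg; rewrite /phase_point omega_state// gamma_state. Qed.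

Lemma derivable_kappa_inv (J : set R) (k : R -> 'M[R]_n) (x : R -> 'cV[R]_n) (t : R) :
  open J -> J t -> (forall s, J s -> so (k s)) ->
  derivable k t 1 -> derivable x t 1 ->
  derivable (fun s => kappa_inv rho m I (x s) (k s)) t 1.
Proof.
move=> oJ Jt sk kd xd.
apply: (@near_eq_derivable _ _ _ (fun s => kappa_solve rho m I (x s) (k s)));
  last exact: derivable_kappa_solve.
near=> s; have Js : J s by near: s; exact: open_nbhs_nbhs.
by rewrite (kappa_invE rho m_gt0 hI)//; exact: sk.
Unshelve. all: by end_near. Qed.

Lemma full_equations_motion (J : set R) (k g : R -> 'M[R]_n) (x : R -> 'cV[R]_n) :
  open J -> full_equations c sigma rho m I J k g x ->
  let q t := (g t, radius *: (g t *m x t)) : ambient in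
  motion c sigma rho m I J q /\
  forall t, J t -> phase_point c sigma rho m I (q t, 'D_1 q t) = (k t, g t, x t).
Proof.
move=> oJ H q; pose w t := kappa_inv rho m I (x t) (k t).
have HJ t : J t -> [/\ so (k t), SO (g t) & sphere (x t)].
  by case/H => -[[]].
have wP t : J t -> so (w t) /\ kappa rho m I (x t) (w t) = k t.
  by case/HJ => sk _ _; rewrite /w (kappa_invE rho m_gt0 hI)//; exact: kappa_solveK.
have qd t : J t -> is_derive t 1 q (state (g t) (w t) (x t)).2.
  move=> Jt; have [_ [_ gd xd]] := H t Jt; apply/is_derive_pairP; split=> //=.
  (* The terms from [g'] and [x'] add up to [radius (1 - eps) g w x = pm rho g w x], so the
     equations for [g] and [x] already contain the no-slip condition. *)
  apply: (is_derive_eq (is_deriveZ radius (is_derive_mulmx gd xd))).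
  rewrite -(epsilonE sigma_gt0 rho_gt0 hc) -mulmxA -scalemxAr -/(w t).
  rewrite scalerBl scale1r addrC subrK scalerA; congr (_ *: _).
  by have := radius_neq0 sigma_gt0 rho_gt0 hc => r0; field.
have qE t : J t -> (q t, 'D_1 q t) = state (g t) (w t) (x t).
  by case/qd => _ ->.
have phaseE t : J t ->
    phase_point c sigma rho m I (q t, 'D_1 q t) = (k t, g t, x t).
  move=> Jt; have [_ sg _] := HJ t Jt.
  by rewrite qE// phase_point_state//; case: (wP t Jt) => _ ->.
have KE t : J t -> kappa rho m I (gam (q t)) (omega (q t) ('D_1 q t)) = k t.
  by move/phaseE; case.
have wE t : J t -> omega (q t) ('D_1 q t) = w t.
  move=> Jt; have [_ sg _] := HJ t Jt.
  have /= := omega_state c sigma rho (w t) (x t) sg.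
  by have := congr1 (fun s : ambient * ambient => omega s.1 s.2) (qE t Jt) => /= ->.
split=> //; apply/motionP => // t Jt.
have [_ [kd gd xd]] := H t Jt; have [sk sg sx] := HJ t Jt.
split.
- by case: (qd t Jt).
- have wd : derivable w t 1.
    apply: (derivable_kappa_inv oJ Jt); first by move=> s /HJ[].
      by case: kd.
    by case: xd.
  have d1 := is_derive_mulmx gd (derivableP wd).
  have d2 := is_deriveZ (pm R c * rho)
    (is_derive_mulmx gd (is_derive_mulmx (derivableP wd) xd)).
  have [dd _] := (is_derive_pairP (fun s => (state (g s) (w s) (x s)).2) t
     (_, _)).2 (conj d1 d2).
  apply: (@near_eq_derivable _ _ _ (fun s => (state (g s) (w s) (x s)).2));
    last exact: dd.
  near=> s; have /qE/(congr1 snd)//= : J s by near: s; exact: open_nbhs_nbhs.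
- by rewrite qE//; apply: (noslip_state sigma_gt0 rho_gt0 hc) => //; case: (wP t Jt).
- rewrite KE// wE//; apply: near_eq_is_derive kd; near=> s.
  by rewrite KE//; near: s; exact: open_nbhs_nbhs.
Unshelve. all: by end_near. Qed.

Lemma motion_full_equations (J : set R) (q : R -> ambient) (k g : R -> 'M[R]_n)
    (x : R -> 'cV[R]_n) : open J -> motion c sigma rho m I J q ->
  (forall t, J t -> phase_point c sigma rho m I (q t, 'D_1 q t) = (k t, g t, x t)) ->
  full_equations c sigma rho m I J k g x.
Proof.
move=> oJ /(motionP q oJ).1 H phaseE t Jt.
have [qd vd D Kd] := H t Jt; have [/= sg sw sx E] := noslipE D.
have [kE gE xE] : [/\ kappa rho m I (gam (q t)) (omega (q t) ('D_1 q t)) = k t,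
    (q t).1 = g t & gam (q t) = x t] by case: (phaseE t Jt).
rewrite -kE -gE -xE; split.
  by split; [split=> //; exact: kappa_so | exact: sx].
rewrite /= (kappa_invK rho m_gt0 hI)//.
have phase s : J s ->
    [/\ kappa rho m I (gam (q s)) (omega (q s) ('D_1 q s)) = k s,
    (q s).1 = g s & gam (q s) = x s] by move/phaseE; case.
split.
- apply: near_eq_is_derive Kd; near=> s.
  by have /phase[] : J s by near: s; exact: open_nbhs_nbhs.
- have [gd _] := (is_derive_pairP _ _ _).1 (derivableP qd).
  have vE : ('D_1 q t).1 = _ := congr1 (fun s : ambient * ambient => s.2.1) E.
  rewrite vE /= in gd.
  apply: near_eq_is_derive gd; near=> s.
  by have /phase[] : J s by near: s; exact: open_nbhs_nbhs.
- have xd := is_derive_gamma sigma_gt0 rho_gt0 hc qd D.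
  apply: near_eq_is_derive xd; near=> s.
  by have /phase[] : J s by near: s; exact: open_nbhs_nbhs.
Unshelve. all: by end_near. Qed.

(** The reduced equations do not involve [g], so [w] is a known continuous function of time and
    [g' = g w] is linear. Starting from the identity is a choice of representative in the orbit. *)
Lemma reduced_equations_lift (J : set R) (k : R -> 'M[R]_n) (x : R -> 'cV[R]_n) :
  open J -> is_interval J -> reduced_equations c sigma rho m I J k x ->
  exists g, full_equations c sigma rho m I J k g x.
Proof.
move=> oJ iJ H; have [[t0 J0]|J0] := pselect (exists t, J t); last first.
  by exists (fun=> 1%:M) => t Jt; exfalso; apply: J0; exists t.
pose w t := kappa_inv rho m I (x t) (k t).
have sk s : J s -> so (k s) by case/H => -[].
have wc t : J t -> {for t, continuous w}.
  move=> Jt; have [_ [kd xd]] := H t Jt.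
  apply/differentiable_continuous/derivable1_diffP.
  by apply: (derivable_kappa_inv oJ Jt sk); [case: kd | case: xd].
have [g [g0 gd]] := linear_ode oJ iJ J0 wc.
exists g => t Jt; have [[sk' sx] [kd xd]] := H t Jt.
split; last by split=> //; exact: gd.
split=> //; split=> //.
apply: (linear_ode_SO iJ J0 _ _ gd) => //; first by rewrite g0; exact: SO1.
move=> s /sk sks; rewrite /w (kappa_invE rho m_gt0 hI)//.
by case: (kappa_solveK rho m_gt0 hI (x s) sks).
Qed.

(** Everything follows from the left invariance of [omega] and [gamma], in which [a] cancels against
    its inverse, and from [a] being an isometry on the [r] component. *)
Lemma lifted_act_symmetry (a : 'M[R]_n) (s : ambient * ambient) :
  SO a -> tangent_bundle c sigma rho s ->
  [/\ tangent_bundle c sigma rho (lifted_act a s),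
      coordinates c sigma rho (lifted_act a s) =
        coord_action a (coordinates c sigma rho s),
      lagrangian m I (lifted_act a s).1 (lifted_act a s).2 =
        lagrangian m I s.1 s.2 &
      noslip (lifted_act a s) <-> noslip s].
Proof.
case: s => -[g r] [v u] sa [[/= sg rr] sw ru].
have aa : a^T *m a = 1%:M by case: sa.
have wE : omega (act a (g, r)) (act a (v, u)) = omega (g, r) (v, u).
  by rewrite /omega/= SO_invmx_mulKmx.
have GE : Gamma c sigma rho (act a (g, r)) = a *m Gamma c sigma rho (g, r).
  by rewrite /Gamma/= -scalemxAr.
have xE : gam (act a (g, r)) = gam (g, r).
  by rewrite /gamma GE SO_invmx_mulKmx.
have tE : tangent_bundle c sigma rho (lifted_act a ((g, r), (v, u))).
  split=> /=; first by split; [exact: SO_mulmx | rewrite dot_mulmx_orthogonal].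
    by rewrite wE.
  by rewrite dot_mulmx_orthogonal.
split=> //.
- rewrite /coordinates/= wE xE /gamma_dot wE xE/= scalemxAr.
  by rewrite SO_invmx_mulKmx.
- by rewrite /lagrangian/= wE dot_mulmx_orthogonal.
- have NE : pm R c * rho *: (Ad (a *m g) (omega (g, r) (v, u)) *m
        (a *m Gamma c sigma rho (g, r))) =
      a *m (pm R c * rho *: (Ad g (omega (g, r) (v, u)) *m Gamma c sigma rho (g, r))).
    move: (Gamma _ _ _ _) (omega _ _) => y w.
    by rewrite -scalemxAr /Ad -!mulmxA SO_invmx_mulKmx.
  split=> -[_ /=]; rewrite ?wE ?GE ?NE => uE; split=> //=.
    by have := congr1 (mulmx a^T) uE; rewrite !mulmxA aa !mul1mx.
  by rewrite wE GE NE -uE.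
Qed.

(** By [motionP] a motion is characterized through [k], [omega] and [gamma], all of them invariant;
    the Euler-Lagrange covector never has to be transported. *)
Lemma motion_act (a : 'M[R]_n) (J : set R) (q : R -> ambient) :
  SO a -> open J -> motion c sigma rho m I J q ->
  motion c sigma rho m I J (fun t => act a (q t)).
Proof.
move=> sa oJ mq.
have H := (motionP q oJ).1 mq.
apply: (motionP (fun t => act a (q t)) oJ).2 => t Jt.
have act_derive s : J s -> is_derive s 1 (fun t => act a (q t)) (act a ('D_1 q s)).
  move=> /H[qd _ _ _]; have [gd rd] := (is_derive_pairP _ _ _).1 (derivableP qd).
  apply/is_derive_pairP; split.
    by have := is_derive_linear_mx (mulmx a) gd.
  by have := is_derive_linear_mx (mulmx a) rd.
have DE s : J s -> 'D_1 (fun t => act a (q t)) s = act a ('D_1 q s).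
  by case/act_derive.
have [qd vd D Kd] := H t Jt.
have inv s : J s -> [/\ omega (act a (q s)) (act a ('D_1 q s)) = omega (q s) ('D_1 q s),
    gam (act a (q s)) = gam (q s) & noslip (act a (q s), act a ('D_1 q s))].
  move=> /H[_ _ Ds _]; have [T _] := Ds.
  have [_ cE _ actD] := lifted_act_symmetry sa T; split; last exact: actD.2.
    exact: (congr1 (fun z => z.1.1.1) cE).
  exact: (congr1 snd cE).
split.
- by case: (act_derive t Jt).
- have [v1d v2d] := (is_derive_pairP _ _ _).1 (derivableP vd).
  have dd : is_derive t 1 (fun s => act a ('D_1 q s)) (act a ('D_1 ('D_1 q) t)).
    apply/is_derive_pairP; split.
      by have := is_derive_linear_mx (mulmx a) v1d.
    by have := is_derive_linear_mx (mulmx a) v2d.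
  apply: (@near_eq_derivable _ _ _ (fun s => act a ('D_1 q s)));
    last by case: dd.
  near=> s.
  by rewrite DE//; near: s; exact: open_nbhs_nbhs.
- by rewrite DE//; case: (inv t Jt).
- have wE s : J s -> omega (act a (q s)) ('D_1 (fun t => act a (q t)) s) =
      omega (q s) ('D_1 q s) by move=> Js; rewrite DE//; case: (inv s Js).
  have KE s : J s -> kappa rho m I (gam (q s)) (omega (q s) ('D_1 q s)) =
      kappa rho m I (gam (act a (q s)))
        (omega (act a (q s)) ('D_1 (fun t => act a (q t)) s)).
    move=> Js; have [_ xE _] := inv s Js.
    exact: esym (congr2 (kappa rho m I) xE (wE s Js)).
  have near_KE : \forall s \near t,
      kappa rho m I (gam (q s)) (omega (q s) ('D_1 q s)) =
      kappa rho m I (gam (act a (q s)))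
        (omega (act a (q s)) ('D_1 (fun t => act a (q t)) s)).
    by near=> s; apply: KE; near: s; exact: open_nbhs_nbhs.
  apply: (is_derive_eq (near_eq_is_derive near_KE Kd)).
  exact: (congr2 (@bracket R n) (KE t Jt) (esym (wE t Jt))).
Unshelve. all: by end_near. Qed.

End Equations.

Theorem proposition1 (R : realType) (n : nat) (c : rolling_case)
    (sigma rho m : R) (I : {linear 'M[R]_n -> 'M[R]_n})
    (sigma_gt0 : 0 < sigma) (rho_gt0 : 0 < rho) (m_gt0 : 0 < m)
    (hc : admissible c sigma rho) (hI : inertia_tensor I) :
  (* (i) *)
  [/\ forall x, sphere x ->
        set_bij (@so R n) (@so R n) (kappa rho m I x),
      set_bij (@noslip_distribution R n c sigma rho) (@phase_space R n)
        (phase_point c sigma rho m I) &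
      forall (J : set R) (k g : R -> 'M[R]_n) (x : R -> 'cV[R]_n),
        open J -> is_interval J ->
        full_equations c sigma rho m I J k g x <->
        exists2 q : R -> 'M[R]_n * 'cV[R]_n, motion c sigma rho m I J q &
          forall t, J t ->
            phase_point c sigma rho m I (q t, 'D_1 q t) = (k t, g t, x t)]
  /\
  (* (ii) *)
  [/\ forall (a : 'M[R]_n) s, SO a -> tangent_bundle c sigma rho s ->
        [/\ tangent_bundle c sigma rho (lifted_act a s),
            coordinates c sigma rho (lifted_act a s) =
              coord_action a (coordinates c sigma rho s),
            lagrangian m I (lifted_act a s).1 (lifted_act a s).2 =
              lagrangian m I s.1 s.2 &
            noslip_distribution c sigma rho (lifted_act a s) <->
              noslip_distribution c sigma rho s],
      forall (a : 'M[R]_n) (J : set R) (q : R -> 'M[R]_n * 'cV[R]_n),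
        SO a -> open J -> is_interval J ->
        motion c sigma rho m I J q ->
        motion c sigma rho m I J (fun t => act a (q t)),
      forall s s', noslip_distribution c sigma rho s -> noslip_distribution c sigma rho s' ->
        reduced_point c sigma rho m I s = reduced_point c sigma rho m I s' <->
        exists2 a : 'M[R]_n, SO a & s' = lifted_act a s,
      reduced_point c sigma rho m I @` noslip_distribution c sigma rho =
        @reduced_space R n &
      forall (J : set R) (k : R -> 'M[R]_n) (x : R -> 'cV[R]_n),
        open J -> is_interval J ->
        reduced_equations c sigma rho m I J k x <->
        exists2 q : R -> 'M[R]_n * 'cV[R]_n, motion c sigma rho m I J q &
          forall t, J t ->
            reduced_point c sigma rho m I (q t, 'D_1 q t) = (k t, x t)].
Proof.
split; split.
- by move=> x _; exact: kappa_bij.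
- split.
  + move=> s /(noslipE sigma_gt0 rho_gt0 hc)[sg sw sx _].
    by split; [split=> //; exact: kappa_so | exact: sx].
  + move=> s s' /set_mem Ds /set_mem Ds'.
    have [_ sw sx E] := noslipE sigma_gt0 rho_gt0 hc Ds.
    have [_ sw' _ E'] := noslipE sigma_gt0 rho_gt0 hc Ds'.
    rewrite /phase_point => -[kE gE xE]; rewrite E E' -gE -xE; congr state.
    by rewrite -xE in kE; apply: kappa_inj kE => //; exact/mem_set.
  + move=> [[k g] x] [[/= sk sg] sx].
    have [sw kE] := kappa_solveK rho m_gt0 hI x sk.
    exists (state c sigma rho g (kappa_solve rho m I x k) x).
      exact: noslip_state.
    by rewrite phase_point_state// kE.
- move=> J k g x oJ iJ; split=> [full|[q mq qE]].
  + have [mq qE] := full_equations_motion sigma_gt0 rho_gt0 m_gt0 hc hI oJ full.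
    by eexists; [exact: mq | exact: qE].
  + exact: (motion_full_equations sigma_gt0 rho_gt0 m_gt0 hc hI oJ mq qE).
- by move=> a s; exact: lifted_act_symmetry.
- by move=> a J q sa oJ _; exact: motion_act.
- move=> s s' Ds Ds'; split=> [|[a sa ->]].
  + have [sg sw sx E] := noslipE sigma_gt0 rho_gt0 hc Ds.
    have [sg' sw' sx' E'] := noslipE sigma_gt0 rho_gt0 hc Ds'.
    (* The rotation [g' g^T] is the one taking [g] to [g']; equal [k] and [x] force equal [w] by
       injectivity of [kappa]. *)
    move=> [kE xE]; exists (s'.1.1 *m s.1.1^T).
      by apply: SO_mulmx => //; exact: SO_trmx.
    rewrite {2}E act_state -mulmxA (proj1 sg) mulmx1 E' -xE.
    congr state; rewrite -xE in kE; apply/esym.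
    by apply: kappa_inj kE => //; exact/mem_set.
  + have [T _] := Ds.
    have [_ cE _ _] := lifted_act_symmetry m I sa T.
    have wE := congr1 (fun z => z.1.1.1) cE; have xE := congr1 snd cE.
    by rewrite /= in wE xE; rewrite /reduced_point wE xE.
- apply/seteqP; split=> [_ [s /(noslipE sigma_gt0 rho_gt0 hc)[sg sw sx _] <-]|].
    by split; [exact: kappa_so | exact: sx].
  move=> [k x] [/= sk sx].
  have [sw kE] := kappa_solveK rho m_gt0 hI x sk.
  exists (state c sigma rho 1%:M (kappa_solve rho m I x k) x).
    by apply: noslip_state => //; exact: SO1.
  rewrite /reduced_point omega_state ?gamma_state ?kE//; exact: SO1.
- move=> J k x oJ iJ; split=> [H|[q mq qE] t Jt].
  + have [g full] := reduced_equations_lift m_gt0 hI oJ iJ H.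
    have [mq qE] := full_equations_motion sigma_gt0 rho_gt0 m_gt0 hc hI oJ full.
    eexists; first exact: mq.
    by move=> t Jt; exact: (congr1 (fun z => (z.1.1, z.2)) (qE t Jt)).
  (* The rotation of the given motion completes [(k, x)] to a solution of the full system, whose
     equations for [k] and [x] are the reduced ones. *)
  + have phaseE s : J s -> phase_point c sigma rho m I (q s, 'D_1 q s) =
        (k s, (q s).1, x s).
      by move=> /qE; rewrite /phase_point /reduced_point => -[-> ->].
    by have [[[sk _] sx] [kd _ xd]] :=
      motion_full_equations sigma_gt0 rho_gt0 m_gt0 hc hI oJ mq phaseE Jt.
Qed.
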